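(* There is an absolute constant $C>0$ such that the following holds. Consider the distributed problem with $L$-Lipschitz gradients, the stochastic oracle with variance bound $\sigma^2$, and the SCAFFOLD algorithm with communication interval $\tau\ge2$, $2R$ communication rounds ($R\ge1$) and $T=2R\tau$ iterations, all as described in the context. Let $\Delta=f(\bar{\mathbf x}_0)-f^*>0$. Assume: (i) (standard Hessian similarity) for some $\delta\in[0,L]$, $\frac1n\sum_{i=1}^n\|\nabla f_i(\mathbf x)-\nabla f(\mathbf x)-\nabla f_i(\mathbf y)+\nabla f(\mathbf y)\|_2^2\le\delta^2\|\mathbf x-\mathbf y\|_2^2$ for all $\mathbf x,\mathbf y\in\mathbb R^d$; (ii) (uniform Hessian similarity) for some $\bar\delta\in[0,2L]$, $\|\nabla f_i(\mathbf x)-\nabla f(\mathbf x)-\nabla f_i(\mathbf y)+\nabla f(\mathbf y)\|_2\le\bar\delta\|\mathbf x-\mathbf y\|_2$ for all $\mathbf x,\mathbf y\in\mathbb R^d$ and all $i\in\{1,\dots,n\}$; (iii) (weak convexity) for some $\rho\in[0,L]$, the function $\mathbf x\mapsto f_i(\mathbf x)+\frac\rho2\mathbf x^{T}\mathbf x$ is convex for every $i\in\{1,\dots,n\}$; (iv) there exists at least one function $\hat f$ in the convex hull $\{\sum_{i=1}^n a_if_i:\ a_i\ge0,\ \sum_{i=1}^n a_i=1\}$ that is twice differentiable with constant Hessian, i.e. $\nabla^2\hat f(\mathbf x)=\nabla^2\hat f(\mathbf y)$ for all $\mathbf x,\mathbf y\in\mathbb R^d$. Then there exists a stepsize $\eta>0$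 such that the iterates of SCAFFOLD satisfy $$\frac2T\sum_{r=0}^{R-1}\sum_{k=0}^{\tau-1}\mathbb E\|\nabla f(\bar{\mathbf x}_{2r\tau+\tau+k})\|_2^2\le C\left(\Big(\frac L\tau+\sqrt{\bar\delta\delta}+\rho\Big)\frac\Delta R+\sqrt{\frac{L\Delta\sigma^2}{n\tau R}}+\frac{(\bar\delta\Delta\sigma)^{2/3}}{\tau^{1/3}R^{2/3}}\right).$$
   Context: Setting. There are $n\ge1$ workers and local functions $f_1,\dots,f_n:\mathbb R^d\to\mathbb R$ (possibly non-convex), each differentiable with $L$-Lipschitz continuous gradient, $L>0$. Put $f=\frac1n\sum_{i=1}^n f_i$, assumed bounded below, and $f^*=\inf_{\mathbf x\in\mathbb R^d}f(\mathbf x)$. Stochastic oracle. At iteration $t\in\{0,\dots,T-1\}$, worker $i$ at point $\mathbf x_t^i$ receives $\mathbf g_t^i=G_i(\mathbf x_t^i,\xi_t^i)$, where $G_i$ is a Borel function, the random variables $\xi_t^i$ are i.i.d. over $t$ for each $i$ and independent across workers $i$, and for all $\mathbf x\in\mathbb R^d$: $\mathbb E_{\xi_t^i}[G_i(\mathbf x,\xi_t^i)]=\nabla f_i(\mathbf x)$ and $\mathbb E_{\xi_t^i}\|G_i(\mathbf x,\xi_t^i)-\nabla f_i(\mathbf x)\|_2^2\le\sigma^2$. SCAFFOLD (simplified variant). Let $\tau\ge2$ be an integer, $R\ge1$, $T=2R\tau$, $\eta>0$ the stepsize. Start from a common deterministic point $\mathbf x_0^1=\dots=\mathbf x_0^n$,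 and write $\bar{\mathbf x}_t=\frac1n\sum_{i=1}^n\mathbf x_t^i$. For $r=0,1,\dots,R-1$: (a) for every $i$ and $k=0,\dots,\tau-1$ set $\mathbf x_{2r\tau+k+1}^i=\mathbf x_{2r\tau+k}^i$; then put $\hat{\mathbf g}_{(r\tau)}^i=\frac1\tau\sum_{k=0}^{\tau-1}\mathbf g_{2r\tau+k}^i$ and $\hat{\mathbf g}_{(r\tau)}=\frac1n\sum_{i=1}^n\hat{\mathbf g}_{(r\tau)}^i$; (b) for every $i$ and $k=\tau,\dots,2\tau-2$ set $\mathbf x_{2r\tau+k+1}^i=\mathbf x_{2r\tau+k}^i-\eta\big(\mathbf g_{2r\tau+k}^i-\hat{\mathbf g}_{(r\tau)}^i+\hat{\mathbf g}_{(r\tau)}\big)$; (c) set $\mathbf x_{2(r+1)\tau}^i=\bar{\mathbf x}_{2(r+1)\tau}=\bar{\mathbf x}_{2r\tau}-\frac\eta n\sum_{j=1}^n\sum_{l=\tau}^{2\tau-1}\mathbf g_{2r\tau+l}^j$ for every $i$. The stepsize may depend on all the problem parameters ($L,\Delta,\sigma,\delta,\bar\delta,\rho,n,\tau,R$). *)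

(* Defs.v *)
From mathcomp Require Import all_boot all_order all_algebra.
From mathcomp Require Import all_classical all_reals all_analysis.
Import Order.TTheory GRing.Theory Num.Theory.
Import numFieldNormedType.Exports.

Set Implicit Arguments.
Unset Strict Implicit.
Unset Printing Implicit Defensive.

Local Open Scope classical_set_scope.
Local Open Scope ring_scope.

(* The library norm `|v| on 'rV_d is the sup norm, whence a separate Euclidean
   norm. Both induce the same topology, so [differentiable] and [open] below
   have their usual meaning on R^d. *)
Definition l2norm (R : realType) (d : nat) (v : 'rV[R]_d) : R :=
  Num.sqrt (\sum_(j < d) v 0 j ^+ 2).

Definition grad (R : realType) (d : nat) (f : 'rV[R]_d -> R) (x : 'rV[R]_d) :
    'rV[R]_d :=
  \row_j 'D_(delta_mx 0 j) f x.

Definition hessian (R : realType) (d : nat) (f : 'rV[R]_d -> R)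
    (x : 'rV[R]_d) : 'M[R]_d :=
  'J (grad f) x.

Definition borel_rV (R : realType) (d : nat) :=
  g_sigma_algebraType (@open 'rV[R]_d).

Definition avg (R : realType) (n d : nat) (v : 'I_n -> 'rV[R]_d) : 'rV[R]_d :=
  n%:R^-1 *: \sum_(i < n) v i.

Definition favg (R : realType) (n d : nat) (f : 'I_n -> 'rV[R]_d -> R)
    (x : 'rV[R]_d) : R :=
  n%:R^-1 * \sum_(i < n) f i x.

Definition mutually_independent (R : realType) (dO dX : measure_display)
    (Omega : measurableType dO) (Xi : measurableType dX)
    (P : probability Omega R) (I : finType) (X : I -> Omega -> Xi) : Prop :=
  forall (J : {set I}) (A : I -> set Xi),
    (forall i, i \in J -> measurable (A i)) ->
    P (\bigcap_(i in [set` J]) X i @^-1` A i) =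
      (\prod_(i in J) P (X i @^-1` A i))%E.

Definition identically_distributed (R : realType) (dO dX : measure_display)
    (Omega : measurableType dO) (Xi : measurableType dX)
    (P : probability Omega R) (X Y : Omega -> Xi) : Prop :=
  forall A : set Xi, measurable A -> P (X @^-1` A) = P (Y @^-1` A).

(* The samples [xi t i] with [t < T]; those with [T <= t] are never used. *)
Definition iid_samples (R : realType) (n : nat) (dO dX : measure_display)
    (Omega : measurableType dO) (Xi : measurableType dX)
    (P : probability Omega R) (T : nat)
    (xi : nat -> 'I_n -> {RV P >-> Xi}) : Prop :=
  mutually_independent P (fun p : 'I_T * 'I_n => xi p.1 p.2 : Omega -> Xi) /\
  forall (s t : nat) (i : 'I_n), (s < T)%N -> (t < T)%N ->
    identically_distributed P (xi s i) (xi t i).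

(* [G x z] is the stochastic gradient at the point [x] for the sample [z]. *)
Definition stochastic_oracle (R : realType) (d : nat)
    (dO dX : measure_display) (Omega : measurableType dO)
    (Xi : measurableType dX) (P : probability Omega R)
    (f : 'rV[R]_d -> R) (sigma : R) (G : 'rV[R]_d -> Xi -> 'rV[R]_d)
    (z : Omega -> Xi) : Prop :=
  forall x : 'rV[R]_d,
    (forall j : 'I_d,
       P.-integrable [set: Omega] (EFin \o (fun w => G x (z w) 0 j)) /\
       ('E_P[fun w => (G x (z w) 0 j)%R])%E = (grad f x 0 j)%:E) /\
    ('E_P[fun w => (l2norm (G x (z w) - grad f x) ^+ 2)%R] <= (sigma ^+ 2)%:E)%E.

Definition convex_comb (R : realType) (n d : nat) (a : 'I_n -> R)
    (f : 'I_n -> 'rV[R]_d -> R) (x : 'rV[R]_d) : R :=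
  \sum_(i < n) a i * f i x.

Definition constant_hessian (R : realType) (d : nat) (f : 'rV[R]_d -> R) :
    Prop :=
  [/\ forall x, differentiable f x,
      forall x, differentiable (grad f) x &
      forall x y, hessian f x = hessian f y].

Definition ghat (R : realType) (n d tau : nat)
    (g : nat -> 'I_n -> 'rV[R]_d) (r : nat) (i : 'I_n) : 'rV[R]_d :=
  tau%:R^-1 *: \sum_(0 <= k < tau) g (2 * r * tau + k)%N i.

(* [x t i] is the iterate of worker [i] at time [t] and [g t i] the stochastic
   gradient it receives there (along a fixed outcome); [N] is the number of
   indices r, so that the recursion determines [x t] for [t <= 2 * N * tau]. *)
Record scaffold (R : realType) (n d tau N : nat) (eta : R) (x0 : 'rV[R]_d)
    (x g : nat -> 'I_n -> 'rV[R]_d) : Prop := Scaffold {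
  scaffold_init : forall i, x 0%N i = x0 ;
  scaffold_frozen : forall (r k : nat) (i : 'I_n), (r < N)%N -> (k < tau)%N ->
    x (2 * r * tau + k).+1 i = x (2 * r * tau + k)%N i ;
  scaffold_local : forall (r k : nat) (i : 'I_n), (r < N)%N ->
    (tau <= k <= 2 * tau - 2)%N ->
    x (2 * r * tau + k).+1 i =
      x (2 * r * tau + k)%N i -
      eta *: (g (2 * r * tau + k)%N i - ghat tau g r i + avg (ghat tau g r)) ;
  scaffold_sync : forall (r : nat) (i : 'I_n), (r < N)%N ->
    x (2 * r.+1 * tau)%N i =
      avg (x (2 * r * tau)%N) -
      (eta / n%:R) *:
        \sum_(j < n) \sum_(tau <= l < 2 * tau) g (2 * r * tau + l)%N j
}.

(* Main.v *)
Require Import Defs.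
From HB Require Import structures.
From mathcomp Require Import all_boot all_order all_algebra.
From mathcomp Require Import all_classical all_reals all_analysis.
From mathcomp Require Import measurable_realfun.
From mathcomp Require Import zify ring lra.
Import Order.TTheory GRing.Theory Num.Theory.
Import numFieldNormedType.Exports.

Set Implicit Arguments.
Unset Strict Implicit.
Unset Printing Implicit Defensive.

Local Open Scope classical_set_scope.
Local Open Scope ring_scope.

(** Write [z] for the common point of a round, [xb l] for the average of the
    workers' points after [l] local steps, [m l] for the average of the gradients
    [grad (f i)] at these points, and [X l] for their mean squared distance to
    [xb l]. Since the control variates cancel in the average, [xb] performs a
    gradient step along [m l] perturbed by the average of [n] pairwise orthogonal
    noises, and the descent lemma gives, for a stepsize [eta] of order at most
    [1 / L],

      E f(xb (l+1)) <= E f(xb l) - eta/2 E|grad f(xb l)|^2 - eta/4 E|m l|^2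
                       + 2 eta deltabar^2 E X l + L eta^2 sigma^2 / (2 n).

    The bias term comes from [gradient_bias]. A convex combination of the [f i]
    with constant Hessian has an affine gradient, so averaging this gradient over
    the workers creates no error, and [grad (f i)] differs from it by a
    [2 * deltabar]-Lipschitz map.

    The consensus distance [X] is controlled by three facts. A gradient step on a
    [rho]-weakly convex [L]-smooth function expands distances by at most
    [1 + eta * rho] ([gradient_step_contract], which follows from the cocoercivity
    of the gradient of the convex function [f i + rho/2 |.|^2]). The corrected
    direction differs between workers by [grad (f i) - grad f] at [xb l] minus the
    same at [z], which is of mean square at most [delta^2 |xb l - z|^2]. Finally
    the local noises are orthogonal to the past. With [eta * tau * rho <= 1] the
    resulting recursions for [X] and for the drift [|xb l - z|^2] grow by bounded
    factors over [tau] steps. Hence the sum of [deltabar^2 * X] over a round is at most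

      const (eta tau sqrt(deltabar delta))^4 sum_l E|m l|^2

    up to noise; the negative multiple of [E|m l|^2] in the descent inequality
    absorbs it when [eta * tau * sqrt (deltabar * delta)] is small. This is
    [round_descent]; summing over the rounds gives [total_progress].

    The inverse stepsize is the sum of all the lower bounds required of it,
    including the two that balance the noise terms ([stepsize]), so that no
    similarity or noise parameter has to be assumed nonzero.

    The probabilistic input is the following. For a set [J] of samples and a sample
    [q] outside [J], mutual independence and Dynkin's theorem show that [X q] is
    independent of the sigma-algebra generated by [J]; the joint law is a product
    measure, and Fubini's theorem allows [X q] to be averaged with the past held
    fixed ([freeze_le], [freeze_eq0]). Consequently each noise has second moment at
    most [sigma^2] and is orthogonal to every square-integrable vector that depends
    only on the samples drawn earlier or by the other workers
    ([noise_variance], [adapted_orth]). *)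

(** * Euclidean inner product and averages of vectors *)

Section Euclidean.
Context {R : realType} {d : nat}.
Implicit Types (u v w : 'rV[R]_d) (a : R).

Lemma coordB u v j : (u - v) 0 j = u 0 j - v 0 j.
Proof. by rewrite !mxE. Qed.

(** The Euclidean inner product. *)
Definition dotv u v : R := \sum_(j < d) u 0 j * v 0 j.

Lemma dotvC u v : dotv u v = dotv v u.
Proof. by apply: eq_bigr => j _; rewrite mulrC. Qed.

Lemma dotvDl u v w : dotv (u + v) w = dotv u w + dotv v w.
Proof. by rewrite -big_split; apply: eq_bigr => j _; rewrite mxE mulrDl. Qed.

Lemma dotvZl a u v : dotv (a *: u) v = a * dotv u v.
Proof. by rewrite mulr_sumr; apply: eq_bigr => j _; rewrite mxE mulrA. Qed.

Lemma dotvDr u v w : dotv w (u + v) = dotv w u + dotv w v.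
Proof. by rewrite dotvC dotvDl !(dotvC w). Qed.

Lemma dotvZr a u v : dotv u (a *: v) = a * dotv u v.
Proof. by rewrite dotvC dotvZl dotvC. Qed.

Lemma dotvNl u v : dotv (- u) v = - dotv u v.
Proof. by rewrite -scaleN1r dotvZl mulN1r. Qed.

Lemma dotvNr u v : dotv u (- v) = - dotv u v.
Proof. by rewrite dotvC dotvNl dotvC. Qed.

Lemma dotv0l u : dotv 0 u = 0.
Proof. by rewrite -(scale0r 0) dotvZl mul0r. Qed.

Lemma dotv_suml (I : Type) (r : seq I) (P : pred I) (F : I -> 'rV[R]_d) v :
  dotv (\sum_(i <- r | P i) F i) v = \sum_(i <- r | P i) dotv (F i) v.
Proof.
by apply: (big_morph (fun u => dotv u v)) => [x y|]; rewrite ?dotvDl ?dotv0l.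
Qed.

Lemma dotv_sumr (I : Type) (r : seq I) (P : pred I) (F : I -> 'rV[R]_d) v :
  dotv v (\sum_(i <- r | P i) F i) = \sum_(i <- r | P i) dotv v (F i).
Proof. by rewrite dotvC dotv_suml; apply: eq_bigr => i _; rewrite dotvC. Qed.

Definition dotvE := (dotvDl, dotvDr, dotvZl, dotvZr, dotvNl, dotvNr).

(** The squared Euclidean norm. *)
Definition sqn u : R := dotv u u.

Lemma sqn_ge0 u : 0 <= sqn u.
Proof. by apply: sumr_ge0 => j _; rewrite -expr2 sqr_ge0. Qed.

Lemma sqn0 : sqn 0 = 0. Proof. exact: dotv0l. Qed.

Lemma sqnE u : sqn u = \sum_(j < d) u 0 j ^+ 2.
Proof. by apply: eq_bigr => j _; rewrite expr2. Qed.

Lemma l2norm_sqr u : l2norm u ^+ 2 = sqn u.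
Proof. by rewrite sqr_sqrtr -?sqnE ?sqn_ge0. Qed.

Lemma l2norm_ge0 u : 0 <= l2norm u. Proof. exact: sqrtr_ge0. Qed.

Lemma sqnZ a u : sqn (a *: u) = a ^+ 2 * sqn u.
Proof. by rewrite /sqn !dotvE mulrA. Qed.

Lemma sqnN u : sqn (- u) = sqn u.
Proof. by rewrite /sqn !dotvE opprK. Qed.

Lemma sqnD u v : sqn (u + v) = sqn u + 2 * dotv u v + sqn v.
Proof. by rewrite /sqn !dotvE (dotvC v u); ring. Qed.

Lemma sqnB u v : sqn (u - v) = sqn u - 2 * dotv u v + sqn v.
Proof. by rewrite sqnD sqnN dotvNr; ring. Qed.

Lemma sqn_coord u j : u 0 j ^+ 2 <= sqn u.
Proof.
by rewrite sqnE (bigD1 j) //= lerDl sumr_ge0 // => k _; rewrite sqr_ge0.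
Qed.

(** Young's inequality for the inner product. *)
Lemma dotv_young a u v : 0 < a -> 2 * dotv u v <= a * sqn u + a^-1 * sqn v.
Proof.
move=> a0; have := sqn_ge0 (a *: u - v).
rewrite sqnB sqnZ dotvZl => h.
rewrite -(ler_pM2l a0) mulrDr !mulrA mulfV ?gt_eqF // mul1r.
by rewrite -subr_ge0; apply: le_trans h _; apply/eqP/eqP; lra.
Qed.

Lemma sqnD_young a u v : 0 < a ->
  sqn (u + v) <= (1 + a) * sqn u + (1 + a^-1) * sqn v.
Proof. by move=> a0; rewrite sqnD; have := dotv_young u v a0; lra. Qed.

Lemma sqnD2 u v : sqn (u + v) <= 2 * sqn u + 2 * sqn v.
Proof. by have := sqnD_young u v ltr01; rewrite invr1; lra. Qed.

Lemma dotv_abs u v : `|dotv u v| <= sqn u + sqn v.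
Proof.
have := dotv_young u v ltr01; have := dotv_young (- u) v ltr01.
rewrite sqnN dotvNl invr1 => h1 h2; have := sqn_ge0 u; have := sqn_ge0 v.
by rewrite ler_norml; lra.
Qed.

Lemma cauchy_schwarz u v : dotv u v <= l2norm u * l2norm v.
Proof.
have [u0|u0] := eqVneq (l2norm u) 0.
  have su : sqn u = 0 by rewrite -l2norm_sqr u0 expr0n.
  have uj j : u 0 j = 0.
    by apply/eqP; rewrite -sqrf_eq0 eq_le sqr_ge0 andbT -su sqn_coord.
  by rewrite u0 mul0r /dotv big1 // => j _; rewrite uj mul0r.
have [v0|v0] := eqVneq (l2norm v) 0.
  have sv : sqn v = 0 by rewrite -l2norm_sqr v0 expr0n.
  have vj j : v 0 j = 0.
    by apply/eqP; rewrite -sqrf_eq0 eq_le sqr_ge0 andbT -sv sqn_coord.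
  by rewrite v0 mulr0 /dotv big1 // => j _; rewrite vj mulr0.
have up : 0 < l2norm u by rewrite lt_neqAle eq_sym u0 l2norm_ge0.
have vp : 0 < l2norm v by rewrite lt_neqAle eq_sym v0 l2norm_ge0.
have a0 : 0 < l2norm v / l2norm u by rewrite divr_gt0.
have := dotv_young u v a0; rewrite -!l2norm_sqr invf_div.
have -> : l2norm v / l2norm u * l2norm u ^+ 2 = l2norm u * l2norm v.
  by field.
have -> : l2norm u / l2norm v * l2norm v ^+ 2 = l2norm u * l2norm v.
  by field.
by lra.
Qed.

Lemma sqn_le (c : R) u v : l2norm u <= c * l2norm v ->
  sqn u <= c ^+ 2 * sqn v.
Proof.
move=> h; rewrite -!l2norm_sqr -exprMn.
have h0 := l2norm_ge0 u.
by rewrite ler_sqr // nnegrE // (le_trans h0).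
Qed.

End Euclidean.

Section Averages.
Context {R : realType} {n d : nat}.
Implicit Types (v w : 'I_n -> 'rV[R]_d).

(** The average of [n] real numbers. *)
Definition ravg (a : 'I_n -> R) : R := n%:R^-1 * \sum_(i < n) a i.

Lemma ravgD a b : ravg (fun i => a i + b i) = ravg a + ravg b.
Proof. by rewrite /ravg big_split mulrDr. Qed.

Lemma ravgZ (c : R) a : ravg (fun i => c * a i) = c * ravg a.
Proof. by rewrite /ravg -mulr_sumr mulrCA. Qed.

Lemma ler_ravg (a b : 'I_n -> R) : (forall i, a i <= b i) -> ravg a <= ravg b.
Proof. by move=> h; rewrite ler_wpM2l ?invr_ge0 ?ler0n ?ler_sum. Qed.

Lemma ravg_ge0 (a : 'I_n -> R) : (forall i, 0 <= a i) -> 0 <= ravg a.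
Proof. by move=> h; rewrite mulr_ge0 ?invr_ge0 ?ler0n ?sumr_ge0. Qed.

Lemma avgD v w : avg (fun i => v i + w i) = avg v + avg w.
Proof. by rewrite /avg big_split scalerDr. Qed.

Lemma avgZ (c : R) v : avg (fun i => c *: v i) = c *: avg v.
Proof. by rewrite /avg -scaler_sumr !scalerA mulrC. Qed.

Lemma avgN v : avg (fun i => - v i) = - avg v.
Proof.
by rewrite -scaleN1r -avgZ; congr avg; apply/funext => i; rewrite scaleN1r.
Qed.

Lemma avgB v w : avg (fun i => v i - w i) = avg v - avg w.
Proof. by rewrite avgD avgN. Qed.

Lemma dotv_avgl v u : dotv (avg v) u = ravg (fun i => dotv (v i) u).
Proof. by rewrite /avg dotvZl dotv_suml. Qed.

Hypothesis n_gt0 : (0 < n)%N.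
Let nN0 : n%:R != 0 :> R. Proof. by rewrite pnatr_eq0 -lt0n. Qed.

Lemma avg_cst u : @avg R n d (fun=> u) = u.
Proof.
by rewrite /avg sumr_const card_ord -[u *+ n]scaler_nat scalerA mulVf ?scale1r.
Qed.

Lemma ravg_cst (c : R) : ravg (fun _ : 'I_n => c) = c.
Proof. by rewrite /ravg sumr_const card_ord -[c *+ n]mulr_natl mulrA mulVf ?mul1r. Qed.

(** The second moment about a point [u] exceeds the variance by the squared
    distance from [u] to the mean. *)
Lemma ravg_sqnB v u :
  ravg (fun i => sqn (v i - u)) =
  ravg (fun i => sqn (v i - avg v)) + sqn (avg v - u).
Proof.
have E i : sqn (v i - u) =
    sqn (v i - avg v) + (2 * dotv (v i - avg v) (avg v - u) + sqn (avg v - u)).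
  have -> : v i - u = (v i - avg v) + (avg v - u) by rewrite addrA subrK.
  by rewrite sqnD addrA.
under [X in ravg X]eq_fun do rewrite E.
rewrite !ravgD ravg_cst ravgZ -dotv_avgl avgB avg_cst subrr dotv0l.
by rewrite mulr0 add0r.
Qed.

Lemma ravg_sqnB_le v u :
  ravg (fun i => sqn (v i - avg v)) <= ravg (fun i => sqn (v i - u)).
Proof. by rewrite [leRHS]ravg_sqnB lerDl sqn_ge0. Qed.

(** Jensen's inequality for the squared norm. *)
Lemma sqn_avg_le v : sqn (avg v) <= ravg (fun i => sqn (v i)).
Proof.
have := ravg_sqnB v 0; rewrite subr0.
under eq_fun do rewrite subr0.
by move=> ->; rewrite lerDr ravg_ge0 // => i; rewrite sqn_ge0.
Qed.

End Averages.

(** * Smooth functions on R^d *)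

Section Calculus.
Context {R : realType} {d : nat}.
Implicit Types (f g : 'rV[R]_d -> R) (x y v : 'rV[R]_d).

Lemma is_derive_line f x v (t : R) : (forall y, differentiable f y) ->
  is_derive t 1 (fun s : R => f (x + s *: v)) ('D_v f (x + t *: v)).
Proof.
move=> df; have dl : differentiable (fun s : R => x + s *: v) t.
  by apply: differentiableD; [exact: differentiable_cst|exact: ex_diff].
have dd : differentiable (fun s : R => f (x + s *: v)) t.
  by apply: (@differentiable_comp _ _ _ _ (fun s : R => x + s *: v) f).
apply: DeriveDef; first exact: diff_derivable.
rewrite deriveE // (@diff_comp _ _ _ _ (fun s : R => x + s *: v) f) //.
rewrite [RHS]deriveE // [LHS]/=; congr ('d _ _ _).
rewrite -(deriveE _ dl).
have -> : (fun s : R => x + s *: v) = (cst x : R -> 'rV[R]_d) + ( *:%R^~ v).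
  by [].
rewrite deriveD; [|exact: derivable_cst|exact/diff_derivable/ex_diff].
rewrite derive_cst add0r deriveE; last exact: ex_diff.
by rewrite diff_val scale1r.
Qed.

Lemma derive_grad f x v : differentiable f x -> 'D_v f x = dotv (grad f x) v.
Proof.
move=> df; rewrite deriveE // {1}(row_sum_delta v) linear_sum /=.
apply: eq_bigr => j _; rewrite linearZ /= mxE deriveE // mulrC.
by [].
Qed.

Lemma is_derive_lineE f x v (t : R) : (forall y, differentiable f y) ->
  is_derive t 1 (fun s : R => f (x + s *: v)) (dotv (grad f (x + t *: v)) v).
Proof. by move=> df; rewrite -derive_grad //; exact: is_derive_line. Qed.

Lemma MVT01 (p dp : R -> R) : (forall t : R, is_derive t 1 p (dp t)) ->
  exists2 c, 0 < c < 1 & p 1 - p 0 = dp c.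
Proof.
move=> dP; have [|c] := @MVT R p dp 0 1 ltr01 (fun t _ => dP t).
- apply: derivable_within_continuous => t _.
  by have [] := dP t.
- by rewrite in_itv /= subr0 mulr1; exists c.
Qed.

(** A function with constant Hessian has an affine gradient: along any line, the
    coordinates of the gradient have a constant derivative. *)
Lemma grad_affine f : constant_hessian f ->
  exists H : 'M[R]_d, forall x v, grad f (x + v) = grad f x + v *m H.
Proof.
case=> df dg hE; exists (hessian f 0) => x v; apply/rowP => j.
have dgj y : differentiable (fun z => grad f z 0 j) y.
  apply: (@differentiable_comp _ _ _ _ (grad f) (fun M : 'rV[R]_d => M 0 j)).
    exact: dg.
  exact: differentiable_coord.
have [c _] := MVT01 (fun t => is_derive_line x v t dgj).
rewrite scale1r scale0r addr0 => /(canRL (subrK _)) ->; rewrite addrC.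
have -> : (grad f x + v *m hessian f 0) 0 j =
    grad f x 0 j + (v *m hessian f 0) 0 j by rewrite mxE.
congr (_ + _).
have := @deriveEjacobian R d d (grad f) (x + c *: v) v (dg _).
rewrite -/(hessian f _) (hE _ 0) => <-.
rewrite !deriveE //
  (@diff_comp _ _ _ _ (grad f) (fun M : 'rV[R]_d => M 0 j)) //=; last first.
  exact: differentiable_coord.
have @l : {linear 'rV[R]_d -> R}.
  by exists (fun N : 'rV[R]_d => N 0 j); do 2![eexists]; do ?[constructor];
     rewrite ?mxE// => ? *; rewrite ?mxE//; move=> ?; rewrite !mxE.
have lc : continuous l by exact: coord_continuous.
by rewrite (diff_lin _ lc).
Qed.

Lemma differentiable_lincomb (I : finType) (a : I -> R) (F : I -> 'rV[R]_d -> R)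
    x : (forall i, differentiable (F i) x) ->
  differentiable (fun y => \sum_i a i * F i y) x.
Proof.
move=> dF; have -> : (fun y => \sum_i a i * F i y) = \sum_i (a i *: F i).
  by apply/funext => y; rewrite fct_sumE.
elim/big_ind: _ => [|p q dp dq|i _].
- exact: differentiable_cst.
- exact: differentiableD.
- exact: differentiableZ.
Qed.

Lemma grad_lincomb (I : finType) (a : I -> R) (F : I -> 'rV[R]_d -> R) x :
  (forall i, differentiable (F i) x) ->
  grad (fun y => \sum_i a i * F i y) x = \sum_i a i *: grad (F i) x.
Proof.
move=> dF; apply/rowP => j; rewrite summxE mxE.
have -> : (fun y => \sum_i a i * F i y) = \sum_i (a i *: F i).
  by apply/funext => y; rewrite fct_sumE.
transitivity (\sum_i 'D_(delta_mx 0 j) (a i *: F i) x).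
  have dd i : derivable (a i *: F i) x (delta_mx 0 j).
    exact/diff_derivable/differentiableZ.
  suff [] : derivable (\sum_i (a i *: F i)) x (delta_mx 0 j) /\
    'D_(delta_mx 0 j) (\sum_i (a i *: F i)) x =
      \sum_i 'D_(delta_mx 0 j) (a i *: F i) x by [].
  elim/big_ind2: _ => [|p p' q q' [h1 <-] [h2 <-]|i _].
  - by split; [exact: derivable_cst|exact: derive_cst].
  - by split; [exact: derivableD|exact: deriveD].
  - by [].
by apply: eq_bigr => i _; rewrite deriveZ ?mxE //; exact: diff_derivable.
Qed.

(** The descent lemma. *)
Lemma descent (L : R) f x y : (forall y, differentiable f y) ->
  (forall y z, l2norm (grad f y - grad f z) <= L * l2norm (y - z)) ->
  f y <= f x + dotv (grad f x) (y - x) + L / 2 * sqn (y - x).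
Proof.
move=> df lip; set v := y - x.
pose c0 := dotv (grad f x) v.
pose c1 := L / 2 * sqn v.
pose p t := f (x + t *: v) - (t * c0 + t ^+ 2 * c1).
pose dp t := dotv (grad f (x + t *: v)) v - (c0 + 2 * t * c1).
have dP (t : R) : is_derive t 1 p (dp t).
  apply: is_deriveB; first exact: is_derive_lineE.
  apply: is_deriveD.
    have -> : (fun s : R => s * c0) = c0 *: id.
      by apply/funext => s; rewrite [LHS]mulrC.
    by apply: is_derive_eq; rewrite /GRing.scale /= mulr1.
  have -> : (fun s : R => s ^+ 2 * c1) = c1 *: (id ^+ 2).
    by apply/funext => s; rewrite [LHS]mulrC.
  apply: is_derive_eq.
  by rewrite /GRing.scale /= expr1 mulr1 mulrC -mulr_natl.
have [c /andP[c0' _]] := MVT01 dP.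
have : dp c <= 0.
  rewrite /dp /c0 /c1.
  have -> : dotv (grad f (x + c *: v)) v - (dotv (grad f x) v + 2 * c * (L / 2 * sqn v))
    = dotv (grad f (x + c *: v) - grad f x) v - L * c * sqn v.
    by rewrite !dotvE; field.
  rewrite subr_le0; apply: le_trans (cauchy_schwarz _ _) _.
  apply: le_trans (ler_wpM2r (l2norm_ge0 v) (lip _ _)) _.
  have -> : x + c *: v - x = c *: v by rewrite addrC addKr.
  suff -> : l2norm (c *: v) = c * l2norm v by rewrite -l2norm_sqr expr2 !mulrA.
  apply: (@pexpIrn _ 2) => //; rewrite ?nnegrE ?mulr_ge0 ?l2norm_ge0 ?(ltW c0') //.
  by rewrite exprMn !l2norm_sqr sqnZ.
move=> h e; have : p 1 <= p 0 by rewrite -subr_le0 e.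
have -> : y = x + v by rewrite addrC subrK.
rewrite /p !scale1r scale0r addr0 expr1n expr0n /= !mul0r !mul1r.
rewrite /c0 /c1; lra.
Qed.

(** The first-order inequality for the convex function [f + rho/2 |.|^2], stated
    in terms of [f]. *)
Lemma weakly_convex_ge (rho : R) f x y : (forall y, differentiable f y) ->
  convex_function [set: 'rV[R]_d] (fun y => f y + rho / 2 * (y *m y^T) 0 0) ->
  f x + dotv (grad f x) (y - x) - rho / 2 * sqn (y - x) <= f y.
Proof.
move=> df cvx; set v := y - x.
pose a := f y + rho / 2 * sqn v - f x.
(* [p t] is the value at [x + t v] of the convex function minus that of its chord;
   it is nonpositive on ]0, 1[ and vanishes at 0, so its derivative at 0 is
   nonpositive *)
pose p t := f (x + t *: v) + rho / 2 * (t ^+ 2 * sqn v) - f x - t * a.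
have mxE' (z : 'rV[R]_d) : (z *m z^T) 0 0 = sqn z.
  by rewrite mxE; apply: eq_bigr => j _; rewrite mxE.
have p_le0 t : 0 < t < 1 -> p t <= 0.
  move=> /andP[t0 t1].
  pose tt := Itv01 (ltW t0) (ltW t1).
  have := cvx tt y x (in_setT _) (in_setT _).
  rewrite !mxE' convRE /=.
  have -> : conv tt (y : convex_lmodType 'rV[R]_d) x = x + t *: v :> 'rV[R]_d.
    transitivity (t *: y + (1 - t) *: x); first by [].
    by rewrite /v scalerBr scalerBl scale1r addrCA addrA.
  rewrite /p /a /v sqnB.
  have -> : sqn (x + t *: (y - x)) = (1 - t) ^+ 2 * sqn x
      + 2 * t * (1 - t) * dotv y x + t ^+ 2 * sqn y.
    by rewrite sqnD sqnZ sqnB !dotvE (dotvC x y) -/(sqn x); ring.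
  rewrite -subr_le0 => h; apply: le_trans h.
  by rewrite le_eqVlt; apply/orP; left; apply/eqP; rewrite /unstable.onem; field.
have p0 : p 0 = 0.
  by rewrite /p scale0r addr0 expr0n /= !mul0r mulr0 addr0 subrr subr0.
have dp : is_derive (0 : R) 1 p (dotv (grad f x) v - a).
  have d1 := is_derive_lineE x v (0 : R) df.
  rewrite scale0r addr0 in d1.
  have -> : p = (fun s : R => f (x + s *: v)) +
      (rho / 2 * sqn v) *: (id ^+ 2) - cst (f x) - a *: id.
    apply/funext => t; rewrite /p.
    transitivity (f (x + t *: v) + (rho / 2 * sqn v) * t ^+ 2 - f x - a * t).
      by ring.
    by [].
  apply: is_derive_eq.
  by rewrite /GRing.scale /=; ring.
have : dotv (grad f x) v - a <= 0.
  have [dv <-] := dp.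
  have dvr : h^-1 *: ((p \o shift 0) (h *: 1) - p 0) @[h --> 0^'+] --> 'D_1 p 0.
    by apply: cvg_dnbhs_at_right; exact: dv.
  apply: (cvgr_to_le dvr); near=> h.
  have h0 : 0 < h by [].
  rewrite p0 subr0 /= addr0 [_ *: 1]mulr1 pmulr_rle0 ?invr_gt0 //.
  apply: p_le0; rewrite h0 /=.
  by near: h; exact: nbhs_right_lt.
rewrite /a; lra.
Unshelve. all: by end_near.
Qed.

(** Baillon-Haddad inequality: a convex function with an upper quadratic bound
    has a cocoercive gradient. *)
Lemma cocoercive (M : R) (h : 'rV[R]_d -> R) (gh : 'rV[R]_d -> 'rV[R]_d) x y :
  0 < M ->
  (forall x y, h x + dotv (gh x) (y - x) <= h y) ->
  (forall x y, h y <= h x + dotv (gh x) (y - x) + M / 2 * sqn (y - x)) ->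
  sqn (gh x - gh y) <= M * dotv (gh x - gh y) (x - y).
Proof.
move=> M0 lo up.
have half a b : h a + dotv (gh a) (b - a) + (2 * M)^-1 * sqn (gh b - gh a) <= h b.
  (* compare [a] and [b] at a gradient step from [b] *)
  pose z := b - M^-1 *: (gh b - gh a).
  have l := lo a z; have u := up b z.
  have zb : z - b = - (M^-1 *: (gh b - gh a)) by rewrite /z addrC addKr.
  have za : z - a = (b - a) + (z - b).
    by rewrite [RHS]addrC addrA subrK.
  move: l u; rewrite za zb dotvDr !dotvNr !dotvZr sqnN sqnZ.
  have -> : M / 2 * (M^-1 ^+ 2 * sqn (gh b - gh a)) =
      (2 * M)^-1 * sqn (gh b - gh a) by field; rewrite gt_eqF.
  have E : M^-1 * sqn (gh b - gh a) =
      M^-1 * dotv (gh b) (gh b - gh a) - M^-1 * dotv (gh a) (gh b - gh a).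
    by rewrite {1}/sqn dotvDl dotvNl mulrBr.
  have E2 : (2 * M)^-1 * sqn (gh b - gh a) = M^-1 * sqn (gh b - gh a) / 2.
    by rewrite invfM; ring.
  rewrite E2; lra.
have := half x y; have := half y x.
have -> : sqn (gh y - gh x) = sqn (gh x - gh y) by rewrite -sqnN opprB.
have -> : y - x = - (x - y) by rewrite opprB.
rewrite dotvNr => h1 h2.
have : M^-1 * sqn (gh x - gh y) <= dotv (gh x - gh y) (x - y).
  have -> : M^-1 * sqn (gh x - gh y) = (2 * M)^-1 * sqn (gh x - gh y) * 2.
    by rewrite invfM; field; rewrite gt_eqF.
  by rewrite dotvDl dotvNl; lra.
by rewrite ler_pdivrMl.
Qed.

(** Two gradient steps on a smooth and [rho]-weakly convex function expand the
    distance between their starting points by at most [1 + eta * rho]. *)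
Lemma gradient_step_contract (L rho eta : R) f x y : 0 < L -> 0 <= rho ->
  0 < eta -> eta * (L + rho) <= 2 ->
  (forall y, differentiable f y) ->
  (forall y z, l2norm (grad f y - grad f z) <= L * l2norm (y - z)) ->
  convex_function [set: 'rV[R]_d] (fun y => f y + rho / 2 * (y *m y^T) 0 0) ->
  sqn ((x - y) - eta *: (grad f x - grad f y)) <= (1 + eta * rho) ^+ 2 * sqn (x - y).
Proof.
move=> L0 rho0 eta0 etaM df lip cvx.
pose h z := f z + rho / 2 * sqn z.
pose gh z := grad f z + rho *: z.
have lo a b : h a + dotv (gh a) (b - a) <= h b.
  have := weakly_convex_ge a b df cvx.
  by rewrite /h /gh !dotvE sqnB (dotvC b a) -/(sqn a); lra.
have up a b : h b <= h a + dotv (gh a) (b - a) + (L + rho) / 2 * sqn (b - a).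
  have := descent a b df lip.
  by rewrite /h /gh !dotvE sqnB (dotvC b a) -/(sqn a); lra.
have M0 : 0 < L + rho by rewrite ltr_wpDr.
have := cocoercive x y M0 lo up.
set g := gh x - gh y; set u := x - y => co.
have -> : u - eta *: (grad f x - grad f y) = (1 + eta * rho) *: u - eta *: g.
  by apply/rowP => j; rewrite /g /gh /u !mxE; ring.
rewrite sqnB !sqnZ dotvZl dotvZr.
have gu : 0 <= dotv g u by rewrite -(pmulr_rge0 _ M0) (le_trans (sqn_ge0 g)).
have e2 : 0 <= eta ^+ 2 by rewrite sqr_ge0.
have h1 : eta ^+ 2 * sqn g <= eta ^+ 2 * ((L + rho) * dotv g u) by rewrite ler_wpM2l.
have h2 : eta ^+ 2 * ((L + rho) * dotv g u) <= eta * 2 * dotv g u.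
  rewrite mulrA ler_wpM2r // expr2 -mulrA ler_wpM2l // ltW //.
have h3 : 0 <= eta * rho * (eta * dotv g u) by rewrite !mulr_ge0 // ltW.
rewrite (dotvC u g); nra.
Qed.

End Calculus.

(** * Borel measurability on R^d *)

Section BorelRV.
Context {R : realType} {d : nat}.

(** The open boxes with rational center and size form a countable base of R^d,
    hence measurability into R^d is checked coordinate by coordinate. *)
Lemma measurable_rV (dT : measure_display) (T : measurableType dT)
    (F : T -> 'rV[R]_d) :
  (forall j, measurable_fun [set: T] (fun t => F t 0 j)) ->
  measurable_fun [set: T] (F : T -> borel_rV R d).
Proof.
move=> mF; apply: (@measurability _ _ T (borel_rV R d) setT F (@open 'rV[R]_d)) => //.
move=> _ [U oU <-]; rewrite setTI.
pose B (p : 'rV[rat]_d * rat) : set 'rV[R]_d :=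
  [set y | forall j, ball (ratr (p.1 0 j) : R) (ratr p.2) (y 0 j)].
pose V p : set T := if `[< B p `<=` U >] then F @^-1` B p else set0.
have -> : F @^-1` U = \bigcup_p V p.
  apply/seteqP; split => [t Ut|t [p _]]; last first.
    by rewrite /V; case: asboolP => // + Bt; exact.
  have /nbhs_ballP[e /= e0 eU] : nbhs (F t) U by apply: open_nbhs_nbhs.
  have e20 : 0 < e / 2 by rewrite divr_gt0.
  (* a rational radius [r] below [e / 2], and a rational center within [r] *)
  have [r] := rat_in_itvoo e20; rewrite in_itv /= => /andP[r0 re].
  have /choice[q hq] j : exists q : rat, `|F t 0 j - ratr q| < ratr r.
    have [|q] := @rat_in_itvoo R (F t 0 j - ratr r) (F t 0 j + ratr r); first lra.
    rewrite in_itv /= => /andP[q1 q2]; exists q.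
    by rewrite ltr_norml; apply/andP; split; lra.
  exists (\row_j q j, r) => //; rewrite /V asboolT.
    move=> j /=; rewrite mxE /ball /= distrC; exact: hq.
  move=> y By; apply: eU; split => // i j; rewrite (ord1 i).
  have := By j; have := hq j; rewrite /= mxE /ball /= => h1 h2.
  rewrite (_ : F t 0 j - y 0 j = (F t 0 j - ratr (q j)) + (ratr (q j) - y 0 j)).
    by apply: le_lt_trans (ler_normD _ _) _; lra.
  by rewrite addrA subrK.
apply: countable_bigcupT_measurable => [|p]; first exact: countableP.
rewrite /V; case: asboolP => // _.
have -> : F @^-1` B p = \bigcap_(j in [set: 'I_d])
    ((fun t => F t 0 j) @^-1` ball (ratr (p.1 0 j) : R) (ratr p.2)).
  by apply/seteqP; split => t /= h j; [move=> _; exact: h|exact: h].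
apply: fin_bigcap_measurable => // j _; rewrite -[X in measurable X]setTI.
by apply: mF => //; exact: measurable_ball.
Qed.

Lemma continuous_measurable_rV (g : 'rV[R]_d -> R) : continuous g ->
  measurable_fun [set: borel_rV R d] (g : borel_rV R d -> R).
Proof.
move=> /continuousP cg; apply: (measurability _ (RGenOpens.measurableE R)).
move=> _ [_ [a [b ->] <-]]; rewrite setTI; apply: sub_sigma_algebra.
exact/cg/interval_open.
Qed.

Lemma measurable_rV_coord (dT : measure_display) (T : measurableType dT)
    (F : T -> borel_rV R d) j : measurable_fun [set: T] F ->
  measurable_fun [set: T] (fun t => (F t : 'rV[R]_d) 0 j).
Proof.
move=> mF; have mc := continuous_measurable_rV (@coord_continuous R 1 d 0 j).
exact: (measurableT_comp mc mF).
Qed.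

Lemma measurable_sqn (dT : measure_display) (T : measurableType dT)
    (F : T -> borel_rV R d) : measurable_fun [set: T] F ->
  measurable_fun [set: T] (fun t => sqn (F t : 'rV[R]_d)).
Proof.
move=> mF; apply: measurable_sum => j.
by apply: measurable_funM; exact: (measurable_rV_coord j mF).
Qed.

Lemma measurable_rVD (dT : measure_display) (T : measurableType dT)
    (F H : T -> 'rV[R]_d) :
  measurable_fun [set: T] (F : T -> borel_rV R d) ->
  measurable_fun [set: T] (H : T -> borel_rV R d) ->
  measurable_fun [set: T] ((fun t => F t + H t) : T -> borel_rV R d).
Proof.
move=> mF mH; apply: measurable_rV => j; under eq_fun do rewrite mxE.
by apply: measurable_funD; [exact: (measurable_rV_coord j mF)|
  exact: (measurable_rV_coord j mH)].
Qed.

Lemma measurable_rVZ (dT : measure_display) (T : measurableType dT) (c : R)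
    (F : T -> 'rV[R]_d) :
  measurable_fun [set: T] (F : T -> borel_rV R d) ->
  measurable_fun [set: T] ((fun t => c *: F t) : T -> borel_rV R d).
Proof.
move=> mF; apply: measurable_rV => j; under eq_fun do rewrite mxE.
by apply: measurable_funM => //; exact: (measurable_rV_coord j mF).
Qed.

End BorelRV.

(** * Independence and conditioning on the past *)

Section Independence.
Context {R : realType} {dO dX : measure_display} {Omega : measurableType dO}
  {Xi : measurableType dX} (P : probability Omega R) {I : finType}
  (X : I -> {mfun Omega >-> Xi}).
Implicit Types (J : {set I}) (q : I).

(** The cylinders determined by the variables indexed by [J]; they form a
    pi-system. *)
Definition cylinders J : set (set Omega) :=
  [set C | exists2 A : I -> set Xi, (forall i, measurable (A i)) &
     C = \bigcap_(i in [set` J]) X i @^-1` A i].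

(** The sample space equipped with the sigma-algebra generated by the variables
    indexed by [J]. *)
Definition past J := g_sigma_algebraType (cylinders J).

Lemma cylinders_setI J : setI_closed (cylinders J).
Proof.
move=> _ _ [A mA ->] [B mB ->]; exists (fun i => A i `&` B i).
  by move=> i; exact: measurableI.
by rewrite -bigcapI; apply: eq_bigcapr => i _; rewrite preimage_setI.
Qed.

Lemma cylinders_measurable J C : cylinders J C -> measurable C.
Proof.
move=> [A mA ->]; apply: fin_bigcap_measurable => // i _.
by rewrite -[X in measurable X]setTI; exact: measurable_funP.
Qed.

Lemma past_measurable J (C : set Omega) :
  measurable (C : set (past J)) -> measurable C.
Proof.
move: C; apply: smallest_sub => //; first exact: sigma_algebra_measurable.
by move=> C; exact: cylinders_measurable.
Qed.

Lemma measurable_past J i : i \in J ->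
  measurable_fun [set: past J] (X i : past J -> Xi).
Proof.
move=> iJ _ B mB; rewrite setTI; apply: sub_sigma_algebra.
exists (fun k => if k == i then B else setT).
  by move=> k; case: ifP.
apply/seteqP; split => [w Bw k _ /=|w /(_ i iJ)]; last by rewrite /= eqxx.
by case: eqP => // ->.
Qed.

Lemma measurable_past_fun J (dT : measure_display) (T : measurableType dT)
    (Y : Omega -> T) :
  measurable_fun [set: past J] (Y : past J -> T) -> measurable_fun [set: Omega] Y.
Proof. by move=> mY _ B mB; apply: (@past_measurable J); exact: mY. Qed.

Context (indep : mutually_independent P (fun i => X i : Omega -> Xi)).

(** By Dynkin's theorem, independence extends from cylinders to all events of the
    past. *)
Lemma indep_past J q (C : set Omega) (B : set Xi) : q \notin J ->
  measurable (C : set (past J)) -> measurable B ->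
  P (C `&` X q @^-1` B) = (P C * P (X q @^-1` B))%E.
Proof.
move=> qJ mC mB; have mXB : measurable (X q @^-1` B).
  by rewrite -[X in measurable X]setTI; exact: measurable_funP.
move: C mC.
apply: (@dynkin_induction _ (past J) (cylinders J)
  (fun C : set Omega => P (C `&` X q @^-1` B) = (P C * P (X q @^-1` B))%E)) => //.
- exact: cylinders_setI.
- by rewrite setTI probability_setT mul1e.
- move=> _ [A mA ->].
  pose A' i := if i == q then B else A i.
  have mA' i : measurable (A' i) by rewrite /A'; case: ifP.
  have A'J i : i \in J -> A' i = A i.
    by rewrite /A'; case: eqP => // -> iJ; rewrite iJ in qJ.
  have -> : \bigcap_(i in [set` J]) X i @^-1` A i =
            \bigcap_(i in [set` J]) X i @^-1` A' i.
    by apply: eq_bigcapr => i iJ; rewrite A'J.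
  have -> : (\bigcap_(i in [set` J]) X i @^-1` A' i) `&` X q @^-1` B =
            \bigcap_(i in [set` q |: J]%SET) X i @^-1` A' i.
    apply/seteqP; split => [w [h1 h2] i /=|w h].
      rewrite !inE => /orP[/eqP ->|]; first by rewrite /A' eqxx.
      exact: h1.
    split => [i iJ|]; first by apply: h; rewrite /= !inE (_ : i \in J) ?orbT.
    by have := h q; rewrite /= !inE eqxx /A' eqxx; exact.
  rewrite !indep; [|by move=> *; exact: mA'..].
  by rewrite big_setU1 //= muleC /A' eqxx.
- move=> C mC PC.
  have mC' := past_measurable mC.
  rewrite probability_setC // muleBl ?fin_num_measure // mul1e -PC.
  rewrite setIC -setDE setIC.
  by rewrite measureD ?(setIC C) // ltey_eq fin_num_measure.
- move=> F mF tF PF.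
  have mF' n := past_measurable (mF n).
  rewrite setI_bigcupl measure_bigcup //.
  + rewrite measure_bigcup //.
    rewrite muleC -(@fineK _ (P (X q @^-1` B))) ?fin_num_measure //.
    rewrite -nneseriesZl // fineK ?fin_num_measure //.
    by apply: eq_eseriesr => n _; rewrite muleC; exact: PF.
  + by move=> n _; exact: measurableI.
  + exact: trivIset_setIr.
Qed.

(** A function of the past and of an independent variable [X q] is integrated by
    first averaging over [X q], since their joint law is a product measure. *)
Section Freezing.
Context (J : {set I}) (q : I) (qJ : q \notin J).

Let idJ_mf : measurable_fun [set: Omega] (fun w => w : past J).
Proof. by move=> _ C mC; rewrite setTI; exact: (past_measurable mC). Qed.

Let idJ : {mfun Omega >-> past J} :=
  HB.pack (fun w : Omega => w : past J)
    (isMeasurableFun.Build _ _ _ _ (fun w : Omega => w : past J) idJ_mf).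

Let pairJ_mf : measurable_fun [set: Omega] (fun w => (w, X q w) : past J * Xi).
Proof. by apply: measurable_fun_pair => //; exact: measurable_funP. Qed.

Let pairJ : {mfun Omega >-> (past J * Xi)%type} :=
  HB.pack (fun w : Omega => (w, X q w) : past J * Xi)
    (isMeasurableFun.Build _ _ _ _ _ pairJ_mf).

Let law1 := distribution P idJ.
Let law2 := distribution P (X q).
Let law12 := distribution P pairJ.

Let law12E (A : set (past J * Xi)) : measurable A ->
  (law1 \x law2)%E A = law12 A.
Proof.
apply: product_measure_unique => B C mB mC.
rewrite /law12 /distribution /pushforward /=.
rewrite -[RHS](@indep_past J q B C) //; congr (P _).
Qed.

Lemma freeze_le (phi : Omega -> Xi -> R) (c : \bar R) :
  measurable_fun [set: past J * Xi] (fun p => phi p.1 p.2) ->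
  (forall w z, 0 <= phi w z) ->
  (forall w, (\int[P]_w' (phi w (X q w'))%:E <= c)%E) ->
  (\int[P]_w (phi w (X q w))%:E <= c)%E.
Proof.
move=> mphi phi0 le_c.
pose F (p : past J * Xi) := (phi p.1 p.2)%:E.
have mF : measurable_fun setT F by exact/measurable_EFinP.
have F0 p : (0 <= F p)%E by rewrite lee_fin.
have -> : (\int[P]_w (phi w (X q w))%:E = \int[law12]_p F p)%E.
  by rewrite ge0_integral_distribution.
rewrite (eq_measure_integral (law1 \x law2)%E); last first.
  by move=> A mA _; apply: esym; exact: (law12E mA).
rewrite fubini_tonelli1 //.
apply: le_trans (_ : \int[law1]_w c <= _)%E; last first.
  have -> : (\int[law1]_w c = c * law1 setT)%E by exact: integral_cst.
  by rewrite (_ : law1 setT = 1%E) ?mule1 //; exact: probability_setT.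
apply: ge0_le_integral => //.
- by move=> w _; exact: integral_ge0.
- exact: measurable_fun_fubini_tonelli_F.
move=> w _; rewrite /fubini_F ge0_integral_distribution //=.
  exact: le_c.
by apply: (measurableT_comp mF); exact: pair1_measurable.
Qed.

Lemma freeze_eq0 (phi : Omega -> Xi -> R) :
  measurable_fun [set: past J * Xi] (fun p => phi p.1 p.2) ->
  P.-integrable setT (fun w => (phi w (X q w))%:E) ->
  (forall w, P.-integrable setT (fun w' => (phi w (X q w'))%:E)) ->
  (forall w, (\int[P]_w' (phi w (X q w'))%:E = 0)%E) ->
  (\int[P]_w (phi w (X q w))%:E = 0)%E.
Proof.
move=> mphi iphi iphiw phi0.
pose F (p : past J * Xi) := (phi p.1 p.2)%:E.
have mF : measurable_fun setT F by exact/measurable_EFinP.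
have -> : (\int[P]_w (phi w (X q w))%:E = \int[law12]_p F p)%E.
  by rewrite integral_distribution.
rewrite (eq_measure_integral (law1 \x law2)%E); last first.
  by move=> A mA _; apply: esym; exact: (law12E mA).
rewrite -integral12_prod_meas1 /=.
  rewrite -[RHS](@integral0 _ _ _ law1 setT); apply: eq_integral => w _.
  rewrite /fubini_F integral_distribution //=.
  - exact: phi0.
  - by apply: (measurableT_comp mF); exact: pair1_measurable.
  - exact: iphiw.
apply/integrableP; split=> //.
rewrite (eq_measure_integral law12); last first.
  by move=> A mA _; exact: (law12E mA).
have /integrableP[] // : law12.-integrable setT F.
exact: integrable_pushforward.
Qed.

End Freezing.

End Independence.

(** * Square-integrable random vectors *)

Section SquareIntegrable.
Context {R : realType} {dO : measure_display} {Omega : measurableType dO}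
  (P : probability Omega R).
Implicit Types (X Y : Omega -> R).

(** The real-valued expectation; meaningful for integrable [X] only. *)
Definition Ex X : R := Rintegral P setT X.

(** Integrable real random variables. *)
Definition itg X : Prop := P.-integrable setT (EFin \o X).

(** Square-integrable real random variables. *)
Definition L2 X : Prop := measurable_fun setT X /\ itg (fun w => X w ^+ 2).

Lemma itgD X Y : itg X -> itg Y -> itg (fun w => X w + Y w).
Proof. by move=> iX iY; exact: (integrableD measurableT iX iY). Qed.

Lemma itgZ (c : R) X : itg X -> itg (fun w => c * X w).
Proof. by move=> iX; exact: (integrableZl measurableT c iX). Qed.

Lemma itgB X Y : itg X -> itg Y -> itg (fun w => X w - Y w).
Proof. by move=> iX iY; exact: (integrableB measurableT iX iY). Qed.

Lemma itg_cst (c : R) : itg (fun=> c).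
Proof. exact: finite_measure_integrable_cst. Qed.

Lemma itg_sum (I : Type) (s : seq I) (Q : pred I) (X : I -> Omega -> R) :
  (forall i, Q i -> itg (X i)) -> itg (fun w => \sum_(i <- s | Q i) X i w).
Proof.
move=> iX; elim: s => [|i s IH].
  by under eq_fun do rewrite big_nil; exact: itg_cst.
under eq_fun do rewrite big_cons.
by case: (boolP (Q i)) => // Qi; apply: itgD => //; exact: iX.
Qed.

Lemma itg_le X Y : measurable_fun setT X -> (forall w, `|X w| <= Y w) ->
  itg Y -> itg X.
Proof.
move=> mX XY; apply: le_integrable => //; first exact/measurable_EFinP.
by move=> w _ /=; rewrite lee_fin (le_trans (XY w)) ?ler_norm.
Qed.

Lemma ExD X Y : itg X -> itg Y -> Ex (fun w => X w + Y w) = Ex X + Ex Y.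
Proof. exact: RintegralD. Qed.

Lemma ExB X Y : itg X -> itg Y -> Ex (fun w => X w - Y w) = Ex X - Ex Y.
Proof. exact: RintegralB. Qed.

Lemma ExZ (c : R) X : itg X -> Ex (fun w => c * X w) = c * Ex X.
Proof. exact: RintegralZl. Qed.

Lemma Ex_cst (c : R) : Ex (fun=> c) = c.
Proof.
have -> : Ex (fun=> c) = c * fine (P setT) by exact: Rintegral_cst.
by rewrite probability_setT mulr1.
Qed.

Lemma Ex_sum (I : Type) (s : seq I) (Q : pred I) (X : I -> Omega -> R) :
  (forall i, Q i -> itg (X i)) ->
  Ex (fun w => \sum_(i <- s | Q i) X i w) = \sum_(i <- s | Q i) Ex (X i).
Proof.
move=> iX; elim: s => [|i s IH].
  by rewrite big_nil; under [X in Ex X]eq_fun do rewrite big_nil; rewrite Ex_cst.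
rewrite big_cons; under [X in Ex X]eq_fun do rewrite big_cons.
case: (boolP (Q i)) => // Qi.
by rewrite ExD ?IH //; [exact: iX|exact: itg_sum].
Qed.

Lemma Ex_le X Y : itg X -> itg Y -> (forall w, X w <= Y w) -> Ex X <= Ex Y.
Proof. by move=> iX iY XY; apply: le_Rintegral. Qed.

Lemma Ex_ge0 X : (forall w, 0 <= X w) -> 0 <= Ex X.
Proof. by move=> X0; apply: Rintegral_ge0. Qed.

Lemma itg_ravg (n : nat) (X : 'I_n -> Omega -> R) :
  (forall i, itg (X i)) -> itg (fun w => ravg (fun i => X i w)).
Proof. by move=> iX; apply: itgZ; exact: itg_sum. Qed.

Lemma Ex_ravg (n : nat) (X : 'I_n -> Omega -> R) : (forall i, itg (X i)) ->
  Ex (fun w => ravg (fun i => X i w)) = ravg (fun i => Ex (X i)).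
Proof. by move=> iX; rewrite ExZ ?Ex_sum //; exact: itg_sum. Qed.

Lemma EFin_Ex X : itg X -> (\int[P]_w (X w)%:E = (Ex X)%:E)%E.
Proof. by move=> iX; rewrite fineK //; exact: integrable_fin_num. Qed.

Lemma L2_mf X : L2 X -> measurable_fun setT X. Proof. by case. Qed.

Lemma L2_le X Y : measurable_fun setT X -> (forall w, X w ^+ 2 <= Y w) ->
  itg Y -> L2 X.
Proof.
move=> mX XY iY; split=> //; apply: itg_le iY; first exact: measurable_funX.
by move=> w; rewrite ger0_norm ?sqr_ge0.
Qed.

Lemma L2_cst (c : R) : L2 (fun=> c).
Proof. by split; [exact: measurable_cst|exact: itg_cst]. Qed.

Lemma L2D X Y : L2 X -> L2 Y -> L2 (fun w => X w + Y w).
Proof.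
move=> [mX iX] [mY iY].
apply: (@L2_le _ (fun w => 2 * X w ^+ 2 + 2 * Y w ^+ 2)).
- exact: measurable_funD.
- by move=> w; have := sqr_ge0 (X w - Y w); rewrite sqrrB sqrrD; lra.
- by apply: itgD; exact: itgZ.
Qed.

Lemma L2Z (c : R) X : L2 X -> L2 (fun w => c * X w).
Proof.
move=> [mX iX]; split; first exact: measurable_funM.
by under eq_fun do rewrite exprMn; exact: itgZ.
Qed.

Lemma itgM X Y : L2 X -> L2 Y -> itg (fun w => X w * Y w).
Proof.
move=> [mX iX] [mY iY].
apply: (@itg_le _ (fun w => X w ^+ 2 + Y w ^+ 2)).
- exact: measurable_funM.
- move=> w; have := sqr_ge0 (X w - Y w); have := sqr_ge0 (X w + Y w).
  rewrite sqrrB sqrrD => h1 h2.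
  have := sqr_ge0 (X w); have := sqr_ge0 (Y w).
  by rewrite ler_norml; lra.
- exact: itgD.
Qed.

Context {d : nat}.
Implicit Types (V W : Omega -> 'rV[R]_d).

(** Square-integrable random vectors. *)
Definition L2v V : Prop := forall j, L2 (fun w => V w 0 j).

Lemma L2v_cst (v : 'rV[R]_d) : L2v (fun=> v).
Proof. by move=> j; exact: L2_cst. Qed.

Lemma L2vD V W : L2v V -> L2v W -> L2v (fun w => V w + W w).
Proof. by move=> lV lW j; under eq_fun do rewrite mxE; exact: L2D. Qed.

Lemma L2vZ (c : R) V : L2v V -> L2v (fun w => c *: V w).
Proof. by move=> lV j; under eq_fun do rewrite mxE; exact: L2Z. Qed.

Lemma L2vN V : L2v V -> L2v (fun w => - V w).
Proof. by move=> lV; under eq_fun do rewrite -scaleN1r; exact: L2vZ. Qed.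

Lemma L2vB V W : L2v V -> L2v W -> L2v (fun w => V w - W w).
Proof. by move=> lV lW; apply: L2vD => //; exact: L2vN. Qed.

Lemma L2v_sum (I : Type) (s : seq I) (Q : pred I) (V : I -> Omega -> 'rV[R]_d) :
  (forall i, Q i -> L2v (V i)) -> L2v (fun w => \sum_(i <- s | Q i) V i w).
Proof.
move=> lV; elim: s => [|i s IH].
  by under eq_fun do rewrite big_nil; exact: L2v_cst.
under eq_fun do rewrite big_cons.
by case: (boolP (Q i)) => // Qi; apply: L2vD => //; exact: lV.
Qed.

Lemma L2v_avg (n : nat) (V : 'I_n -> Omega -> 'rV[R]_d) :
  (forall i, L2v (V i)) -> L2v (fun w => avg (fun i => V i w)).
Proof. by move=> lV; apply: L2vZ; apply: L2v_sum. Qed.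

Lemma itg_dotv V W : L2v V -> L2v W -> itg (fun w => dotv (V w) (W w)).
Proof. by move=> lV lW; apply: itg_sum => j _; exact: itgM. Qed.

Lemma itg_sqn V : L2v V -> itg (fun w => sqn (V w)).
Proof. by move=> lV; exact: itg_dotv. Qed.

Lemma L2v_rV V : L2v V -> measurable_fun setT (V : Omega -> borel_rV R d).
Proof. by move=> lV; apply: measurable_rV => j; exact: (L2_mf (lV j)). Qed.

Lemma L2v_le V Y : measurable_fun setT (V : Omega -> borel_rV R d) ->
  (forall w, sqn (V w) <= Y w) -> itg Y -> L2v V.
Proof.
move=> mV VY iY j; apply: (@L2_le _ Y) => //; first exact: measurable_rV_coord.
by move=> w; apply: le_trans (VY w); exact: sqn_coord.
Qed.

(** The squared L2 norm of a random vector. *)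
Definition nrm2 V : R := Ex (fun w => sqn (V w)).

Lemma nrm2_ge0 V : 0 <= nrm2 V.
Proof. by apply: Ex_ge0 => w; exact: sqn_ge0. Qed.

Lemma nrm2Z (c : R) V : L2v V -> nrm2 (fun w => c *: V w) = c ^+ 2 * nrm2 V.
Proof.
by move=> lV; rewrite /nrm2 -ExZ; [under eq_fun do rewrite sqnZ|exact: itg_sqn].
Qed.

Lemma nrm2D V W : L2v V -> L2v W ->
  nrm2 (fun w => V w + W w) =
  nrm2 V + 2 * Ex (fun w => dotv (V w) (W w)) + nrm2 W.
Proof.
move=> lV lW; rewrite /nrm2; under eq_fun do rewrite sqnD.
rewrite ExD ?ExD ?ExZ //; do ?[exact: itg_sqn|exact: itg_dotv|apply: itgD|apply: itgZ].
Qed.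

Lemma Ex_dotv_sumr (I : Type) (s : seq I) (Q : pred I)
    (V : I -> Omega -> 'rV[R]_d) W :
  (forall i, Q i -> L2v (V i)) -> L2v W ->
  Ex (fun w => dotv (W w) (\sum_(i <- s | Q i) V i w)) =
  \sum_(i <- s | Q i) Ex (fun w => dotv (W w) (V i w)).
Proof.
move=> lV lW; rewrite -Ex_sum => [|i Qi]; last by apply: itg_dotv => //; exact: lV.
by under eq_fun do rewrite dotv_sumr.
Qed.

(** Pythagoras for pairwise orthogonal random vectors. *)
Lemma nrm2_sum_orth (I : eqType) (s : seq I) (V : I -> Omega -> 'rV[R]_d) (c : R) :
  uniq s -> (forall i, i \in s -> L2v (V i)) ->
  (forall i, i \in s -> nrm2 (V i) <= c) ->
  (forall i k, i \in s -> k \in s -> i != k ->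
     Ex (fun w => dotv (V i w) (V k w)) = 0) ->
  nrm2 (fun w => \sum_(i <- s) V i w) <= (size s)%:R * c.
Proof.
elim: s => [|i s IH] /=.
  move=> _ _ _ _; rewrite mul0r /nrm2; under eq_fun do rewrite big_nil sqn0.
  by rewrite Ex_cst.
move=> /andP[is_ us] lV lc orth.
have lVs k : k \in s -> L2v (V k) by move=> ks; apply: lV; rewrite inE ks orbT.
have lsum : L2v (fun w => \sum_(k <- s) V k w).
  by under eq_fun do rewrite big_seq; exact: L2v_sum.
under [X in nrm2 X]eq_fun do rewrite big_cons.
rewrite nrm2D //; last by apply: lV; rewrite mem_head.
have -> : Ex (fun w => dotv (V i w) (\sum_(k <- s) V k w)) = 0.
  under eq_fun do rewrite big_seq.
  rewrite Ex_dotv_sumr //; last by apply: lV; rewrite mem_head.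
  apply: big1_seq => k /andP[ks _]; apply: orth; rewrite ?mem_head ?inE ?ks ?orbT //.
  by apply: contra is_ => /eqP ->.
rewrite mulr0 addr0 -natr1 mulrDl mul1r addrC lerD //.
- apply: IH => //.
  + by move=> k ks; apply: lc; rewrite inE ks orbT.
  + by move=> k l ks ls; apply: orth; rewrite inE ?ks ?ls orbT.
- by apply: lc; rewrite mem_head.
Qed.

(** Square integrability is preserved by Lipschitz maps. *)
Lemma L2v_lip (g : 'rV[R]_d -> 'rV[R]_d) (L : R) V :
  (forall x y, l2norm (g x - g y) <= L * l2norm (x - y)) ->
  measurable_fun [set: borel_rV R d] (g : borel_rV R d -> borel_rV R d) ->
  L2v V -> L2v (fun w => g (V w)).
Proof.
move=> lip mg lV.
apply: (@L2v_le _ (fun w => 2 * (L ^+ 2 * sqn (V w)) + 2 * sqn (g 0))).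
- exact: (measurableT_comp mg (L2v_rV lV)).
- move=> w; have -> : g (V w) = (g (V w) - g 0) + g 0 by rewrite subrK.
  apply: le_trans (sqnD2 _ _) _; rewrite lerD2r ler_pM2l //.
  by have := sqn_le (lip (V w) 0); rewrite subr0.
- by apply: itgD; [do 2 apply: itgZ; exact: itg_sqn|exact: itg_cst].
Qed.

End SquareIntegrable.

Section LipschitzMeasurable.
Context {R : realType} {d : nat}.

Lemma lipschitz_measurable (g : 'rV[R]_d -> 'rV[R]_d) (L : R) :
  (forall x y, l2norm (g x - g y) <= L * l2norm (x - y)) ->
  measurable_fun [set: borel_rV R d] (g : borel_rV R d -> borel_rV R d).
Proof.
move=> lip; apply: (@measurable_rV _ _ _ (borel_rV R d) g) => j.
apply: continuous_measurable_rV => x.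
apply/(@cvgrPdist_lt _ _ _ _ (nbhs_filter x)) => e e0.
pose a : R := 1 + `|L|; pose b : R := 1 + d%:R.
have a0 : 0 < a by rewrite ltr_wpDr.
have b0 : 0 < b by rewrite ltr_wpDr.
have ab0 : 0 < a * b by rewrite mulr_gt0.
apply/nbhs_ballP; exists (e / (a * b)) => /=; first by rewrite divr_gt0.
move=> y [_ xy].
set r := e / _ in xy.
have r0 : 0 < r by rewrite divr_gt0.
have le_xy : sqn (x - y) <= d%:R * r ^+ 2.
  rewrite sqnE; apply: le_trans (_ : \sum_(k < d) r ^+ 2 <= _).
    apply: ler_sum => k _; rewrite !mxE -[leLHS]real_normK ?num_real //.
    by rewrite ler_sqr ?nnegrE ?normr_ge0 ?(ltW r0) //; apply: ltW; exact: xy.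
  by rewrite sumr_const card_ord -[leLHS]mulr_natl.
have lt_g : sqn (g x - g y) < e ^+ 2.
  apply: le_lt_trans (sqn_le (lip x y)) _.
  apply: le_lt_trans (ler_wpM2l (sqr_ge0 L) le_xy) _.
  have -> : e = a * b * r by rewrite mulrC divfK ?gt_eqF.
  rewrite mulrA [ltRHS]exprMn ltr_pM2r ?exprn_gt0 // exprMn.
  have db : d%:R <= b ^+ 2 :> R.
    by rewrite /b sqrrD; have := ler0n R d; have := sqr_ge0 (d%:R : R); lra.
  apply: le_lt_trans (ler_wpM2l (sqr_ge0 L) db) _.
  rewrite ltr_pM2r ?exprn_gt0 // -[ltLHS]real_normK ?num_real //.
  by rewrite ltr_sqr ?nnegrE ?normr_ge0 ?(ltW a0) // /a; lra.
have := le_lt_trans (sqn_coord (g x - g y) j) lt_g.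
rewrite !mxE -[ltLHS]real_normK ?num_real // ltr_sqr ?nnegrE ?(ltW e0) //.
Qed.

End LipschitzMeasurable.

(** * The noise of a stochastic oracle *)

Section Noise.
Context {R : realType} {dO dX : measure_display} {Omega : measurableType dO}
  {Xi : measurableType dX} (P : probability Omega R) {I : finType}
  (X : I -> {mfun Omega >-> Xi}) {d : nat}.
Context (indep : mutually_independent P (fun i => X i : Omega -> Xi)).
Context (f : 'rV[R]_d -> R) (G : 'rV[R]_d -> Xi -> 'rV[R]_d) (sigma L : R).
Context (lip : forall y z, l2norm (grad f y - grad f z) <= L * l2norm (y - z)).
Context (mG : measurable_fun [set: borel_rV R d * Xi]
       (fun p : borel_rV R d * Xi => G p.1 p.2 : borel_rV R d)).
Context (J : {set I}) (q : I) (qJ : q \notin J).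
Context (oracle : stochastic_oracle P f sigma G (X q)).
Context (Y : Omega -> 'rV[R]_d).
Context (mY : measurable_fun [set: past X J] (Y : past X J -> borel_rV R d)).

(** The difference between the stochastic and the exact gradient at a point
    [Y] that depends on the past only. *)
Let eps w := G (Y w) (X q w) - grad f (Y w).

Let mgrad : measurable_fun [set: borel_rV R d]
  (grad f : borel_rV R d -> borel_rV R d).
Proof. exact: lipschitz_measurable lip. Qed.

Let mnoise : measurable_fun [set: past X J * Xi]
  (fun p => (G (Y p.1) p.2 - grad f (Y p.1)) : borel_rV R d).
Proof.
have mY1 : measurable_fun [set: past X J * Xi] (fun p => Y p.1 : borel_rV R d).
  exact: (measurableT_comp mY measurable_fst).
have mGY : measurable_fun [set: past X J * Xi]
    (fun p => G (Y p.1) p.2 : borel_rV R d).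
  have mp : measurable_fun [set: past X J * Xi]
      (fun p => (Y p.1, p.2) : borel_rV R d * Xi).
    by apply: measurable_fun_pair => //; exact: measurable_snd.
  exact: (measurableT_comp mG mp).
apply: (@measurable_rV _ _ _ (past X J * Xi)%type) => j.
under eq_fun do rewrite coordB.
apply: measurable_funB; first exact: (measurable_rV_coord j mGY).
have mgY : measurable_fun [set: past X J * Xi]
    (fun p => grad f (Y p.1) : borel_rV R d).
  exact: (measurableT_comp mgrad mY1).
exact: (measurable_rV_coord j mgY).
Qed.

Let meps : measurable_fun [set: Omega] (eps : Omega -> borel_rV R d).
Proof.
have mp : measurable_fun [set: Omega] (fun w => (w, X q w) : past X J * Xi).
  apply: measurable_fun_pair => //.
  by move=> _ C mC; rewrite setTI; exact: (past_measurable mC).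
exact: (measurableT_comp mnoise mp).
Qed.

Let noise_integral : (\int[P]_w (sqn (eps w))%:E <= (sigma ^+ 2)%:E)%E.
Proof.
have := freeze_le indep qJ (phi := fun w z => sqn (G (Y w) z - grad f (Y w)))
  (c := (sigma ^+ 2)%:E); apply.
- exact: measurable_sqn mnoise.
- by move=> w z; exact: sqn_ge0.
- move=> w; have [_] := oracle (Y w).
  by rewrite unlock; under eq_integral do rewrite l2norm_sqr.
Qed.

(** The noise at a point of the past is square integrable with the oracle's
    variance bound, although this point need not be bounded. *)
Lemma noise_L2v : L2v P eps.
Proof.
apply: (@L2v_le _ _ _ _ _ _ (fun w => sqn (eps w))) => //.
apply/integrableP; split.
  by apply/measurable_EFinP; exact: measurable_sqn meps.
under eq_integral do rewrite /= ger0_norm ?sqn_ge0 //.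
by apply: le_lt_trans noise_integral _; rewrite ltry.
Qed.

Lemma noise_nrm2 : nrm2 P eps <= sigma ^+ 2.
Proof.
by rewrite -lee_fin -EFin_Ex //; exact: itg_sqn noise_L2v.
Qed.

(** The oracle is unbiased, so the noise is orthogonal to the past. *)
Lemma noise_orth (Z : Omega -> 'rV[R]_d) : L2v P Z ->
  measurable_fun [set: past X J] (Z : past X J -> borel_rV R d) ->
  Ex P (fun w => dotv (Z w) (eps w)) = 0.
Proof.
move=> lZ mZ; rewrite /dotv Ex_sum => [|j _]; last first.
  by apply: itgM; [exact: lZ|exact: noise_L2v].
apply: big1 => j _; apply: EFin_inj.
rewrite -EFin_Ex; last by apply: itgM; [exact: lZ|exact: noise_L2v].
apply: (freeze_eq0 indep qJ
  (phi := fun w z => Z w 0 j * (G (Y w) z - grad f (Y w)) 0 j)).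
- apply: measurable_funM.
    exact: (measurableT_comp (measurable_rV_coord j mZ) measurable_fst).
  exact: (measurable_rV_coord j mnoise).
- by apply: itgM; [exact: lZ|exact: noise_L2v].
- move=> w; apply: itgZ; have [/(_ j)[iG _] _] := oracle (Y w).
  by under eq_fun do rewrite coordB; apply: itgB => //; exact: itg_cst.
- move=> w; have [/(_ j)[iG EG] _] := oracle (Y w).
  have iGc : itg P (fun w' => G (Y w) (X q w') 0 j - grad f (Y w) 0 j).
    by apply: itgB => //; exact: itg_cst.
  under eq_integral do rewrite coordB.
  rewrite (EFin_Ex (itgZ (Z w 0 j) iGc)) ExZ // ExB ?Ex_cst //; last exact: itg_cst.
  move: EG; rewrite unlock (EFin_Ex iG) => -[->].
  by rewrite subrr mulr0.
Qed.

End Noise.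

(** * Heterogeneous objectives *)

Section Heterogeneity.
Context {R : realType} {n d : nat} (n_gt0 : (0 < n)%N).
Context (f : 'I_n -> 'rV[R]_d -> R) (L delta db rho : R).
Context (L_gt0 : 0 < L) (delta_ge0 : 0 <= delta) (db_ge0 : 0 <= db)
  (rho_ge0 : 0 <= rho).
Context (df : forall i y, differentiable (f i) y).
Context (lip : forall i y z,
  l2norm (grad (f i) y - grad (f i) z) <= L * l2norm (y - z)).

Lemma l2norm_le (c : R) (u v : 'rV[R]_d) : 0 <= c ->
  sqn u <= c ^+ 2 * sqn v -> l2norm u <= c * l2norm v.
Proof.
move=> c0; rewrite -!l2norm_sqr -exprMn ler_sqr // nnegrE ?l2norm_ge0 //.
by rewrite mulr_ge0 ?l2norm_ge0.
Qed.

Lemma favgE : favg f = fun y => \sum_i n%:R^-1 * f i y.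
Proof. by apply/funext => y; rewrite /favg mulr_sumr. Qed.

Lemma differentiable_favg y : differentiable (favg f) y.
Proof. by rewrite favgE; exact: differentiable_lincomb. Qed.

Lemma grad_favg y : grad (favg f) y = avg (fun i => grad (f i) y).
Proof. by rewrite favgE grad_lincomb // /avg scaler_sumr. Qed.

Lemma favg_lip y z :
  l2norm (grad (favg f) y - grad (favg f) z) <= L * l2norm (y - z).
Proof.
apply: l2norm_le (ltW L_gt0) _; rewrite !grad_favg -avgB.
apply: le_trans (sqn_avg_le n_gt0 _) _.
apply: le_trans (_ : ravg (fun _ : 'I_n => L ^+ 2 * sqn (y - z)) <= _).
  by apply: ler_ravg => i; exact: sqn_le (lip i y z).
by rewrite ravg_cst.
Qed.

(** Jensen's inequality for the squared norm, with weights. *)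
Lemma sqn_jensen (a : 'I_n -> R) (u : 'I_n -> 'rV[R]_d) :
  (forall i, 0 <= a i) -> \sum_i a i = 1 ->
  sqn (\sum_i a i *: u i) <= \sum_i a i * sqn (u i).
Proof.
move=> a0 a1; set c := \sum_i a i *: u i.
have : 0 <= \sum_i a i * sqn (u i - c).
  by apply: sumr_ge0 => i _; rewrite mulr_ge0 ?sqn_ge0.
have -> : \sum_i a i * sqn (u i - c) =
    \sum_i (a i * sqn (u i) - 2 * dotv (a i *: u i) c + a i * sqn c).
  by apply: eq_bigr => i _; rewrite sqnB dotvZl; ring.
rewrite big_split sumrB /= -mulr_suml a1 mul1r -mulr_sumr -dotv_suml -/c -/(sqn c).
lra.
Qed.

Let h i y := grad (f i) y - grad (favg f) y.

Context (unif : forall i y z,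
  l2norm (grad (f i) y - grad (favg f) y - grad (f i) z + grad (favg f) z)
    <= db * l2norm (y - z)).

Let hE i y z : h i y - h i z =
  grad (f i) y - grad (favg f) y - grad (f i) z + grad (favg f) z.
Proof. by rewrite /h opprB addrA addrAC. Qed.

(** The averaged local gradient is close to the gradient at the average of the
    local points: the affine gradient of [fh] cancels at first order, and the
    remaining differences are [2 * db]-Lipschitz. *)
Lemma gradient_bias (a : 'I_n -> R) (v : 'I_n -> 'rV[R]_d) :
  (forall i, 0 <= a i) -> \sum_(i < n) a i = 1 ->
  constant_hessian (convex_comb a f) ->
  sqn (grad (favg f) (avg v) - avg (fun i => grad (f i) (v i))) <=
  4 * db ^+ 2 * ravg (fun i => sqn (v i - avg v)).
Proof.
move=> a0 a1 /grad_affine[H aff]; set c := avg v.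
pose gh y := \sum_j a j *: grad (f j) y.
have {}aff y : gh y = gh c + (y - c) *m H.
  have ghE z : gh z = grad (convex_comb a f) z by rewrite grad_lincomb.
  by rewrite !ghE -aff addrC subrK.
have avg_gh : avg (fun i => gh (v i)) = gh c.
  under eq_fun do rewrite aff.
  rewrite avgD avg_cst //.
  have -> : avg (fun i => (v i - c) *m H) = avg (fun i => v i - c) *m H.
    by rewrite /avg -scalemxAl mulmx_suml.
  by rewrite avgB avg_cst // subrr mul0mx addr0.
pose hb y := \sum_j a j *: h j y.
have ghhb y : gh y = grad (favg f) y + hb y.
  rewrite /hb; under eq_bigr do rewrite scalerBr.
  by rewrite sumrB -scaler_suml a1 scale1r addrC subrK.
have -> : grad (favg f) c - avg (fun i => grad (f i) (v i)) =
    avg (fun i => (hb (v i) - hb c) - (h i (v i) - h i c)).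
  rewrite avgB [avg (fun i => hb (v i) - hb c)]avgB avg_cst //.
  rewrite [avg (fun i => h i (v i) - h i c)]avgB.
  have -> : avg (fun i => h i c) = 0.
    by rewrite avgB avg_cst // grad_favg subrr.
  have -> : avg (fun i => hb (v i)) =
      gh c - avg (fun i => grad (favg f) (v i)).
    rewrite -avg_gh -avgB; congr avg; apply/funext => i.
    by rewrite ghhb addrC addKr.
  by rewrite avgB ghhb subr0; apply/rowP => j; rewrite !coordB !mxE; ring.
apply: le_trans (sqn_avg_le n_gt0 _) _.
rewrite -ravgZ; apply: ler_ravg => i.
apply: le_trans (sqnD2 _ _) _; rewrite sqnN.
have hi j : sqn (h j (v i) - h j c) <= db ^+ 2 * sqn (v i - c).
  by rewrite hE; exact: sqn_le (unif j (v i) c).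
have : sqn (hb (v i) - hb c) <= db ^+ 2 * sqn (v i - c).
  rewrite /hb -sumrB; under eq_bigr do rewrite -scalerBr.
  apply: le_trans (sqn_jensen _ a0 a1) _.
  apply: le_trans (_ : \sum_j a j * (db ^+ 2 * sqn (v i - c)) <= _).
    by apply: ler_sum => j _; rewrite ler_wpM2l.
  by rewrite -mulr_suml a1 mul1r.
by have := hi i; lra.
Qed.

Context (stdsim : forall y z,
  n%:R^-1 * (\sum_(i < n) l2norm (grad (f i) y - grad (favg f) y
                             - grad (f i) z + grad (favg f) z) ^+ 2)
    <= delta ^+ 2 * l2norm (y - z) ^+ 2).
Context (wcvx : forall i, convex_function [set: 'rV[R]_d]
       (fun y => f i y + rho / 2 * (y *m y^T) 0 0)).

(** The position of worker [i] after a local step from [v i], without the noise of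
    that step and up to a vector common to all workers. Here [c] is the average of
    the workers, [z] the start of the round, and [e i] the error of the gradient
    that worker [i] estimated at [z]. *)
Definition drift (eta : R) (c z : 'rV[R]_d) (v e : 'I_n -> 'rV[R]_d) i :=
  (v i - c - eta *: (grad (f i) (v i) - grad (f i) c))
  - eta *: ((grad (f i) c - grad (favg f) c - grad (f i) z + grad (favg f) z)
            - e i).

Lemma drift_le (eta theta : R) (c z : 'rV[R]_d) (v e : 'I_n -> 'rV[R]_d) :
  0 < theta -> 0 < eta -> eta * (L + rho) <= 2 ->
  ravg (fun i => sqn (drift eta c z v e i)) <=
  (1 + theta) * (1 + eta * rho) ^+ 2 * ravg (fun i => sqn (v i - c)) +
  (1 + theta^-1) * eta ^+ 2 * (2 * (delta ^+ 2 * sqn (c - z)) +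
     2 * ravg (fun i => sqn (e i))).
Proof.
move=> th0 eta0 etaL.
pose hh i := grad (f i) c - grad (favg f) c - grad (f i) z + grad (favg f) z.
have th1 : 0 <= 1 + theta by lra.
have th2 : 0 <= (1 + theta^-1) * eta ^+ 2.
  by rewrite mulr_ge0 ?sqr_ge0 // addr_ge0 // invr_ge0 ltW.
apply: le_trans (_ : ravg (fun i => (1 + theta) * (1 + eta * rho) ^+ 2 *
    sqn (v i - c) + ((1 + theta^-1) * eta ^+ 2) * (2 * sqn (hh i) + 2 * sqn (e i)))
    <= _).
  apply: ler_ravg => i; apply: le_trans (sqnD_young _ _ th0) _.
  rewrite sqnN sqnZ; apply: lerD.
    by rewrite -mulrA ler_wpM2l //; exact: (@gradient_step_contract _ _ L).
  by rewrite mulrA ler_wpM2l // -(sqnN (e i)); exact: sqnD2.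
rewrite ravgD !ravgZ lerD2l ler_wpM2l // ravgD !ravgZ lerD2r ler_wpM2l //.
have := stdsim c z; rewrite l2norm_sqr /ravg.
by under eq_bigr do rewrite l2norm_sqr.
Qed.

(** The vector [y] below is the part of a local step common to all workers. *)
Lemma local_step_drift (eta : R) (c z : 'rV[R]_d)
    (v e eps g gz : 'I_n -> 'rV[R]_d) :
  (forall i, g i = grad (f i) (v i) + eps i) ->
  (forall i, gz i = grad (f i) z + e i) ->
  exists y, forall i, v i - eta *: (g i - gz i + avg gz) - y =
    drift eta c z v e i - eta *: eps i.
Proof.
move=> gE gzE.
exists (c - eta *: grad (favg f) c + eta *: grad (favg f) z - eta *: avg gz) => i.
rewrite gE gzE /drift.
move: (grad (f i) (v i)) (grad (f i) c) (grad (f i) z) (grad (favg f) c)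
  (grad (favg f) z) (avg gz) (eps i) (e i) (v i) => p1 p2 p3 p4 p5 p6 p7 p8 p9.
by apply/rowP => j; rewrite !mxE; ring.
Qed.

End Heterogeneity.

(** * Trajectories of the algorithm *)

(** The time of the first local step in the round [r]. *)
Definition local_start (tau r : nat) := (2 * r * tau + tau)%N.

Lemma round_end (tau r : nat) :
  (local_start tau r + tau)%N = (2 * r.+1 * tau)%N.
Proof. by rewrite /local_start; lia. Qed.

Section Trajectory.
Context {R : realType} {n d tau N : nat} (eta : R) (x0 : 'rV[R]_d)
  (x g : nat -> 'I_n -> 'rV[R]_d).
Context (n_gt0 : (0 < n)%N) (tau_gt1 : (1 < tau)%N).
Context (sc : scaffold tau N eta x0 x g).

Let tau_gt0 : (0 < tau)%N. Proof. exact: ltnW. Qed.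

Local Notation t0 := (local_start tau).

Lemma scaffold_start r i : (r <= N)%N ->
  x (2 * r * tau)%N i = avg (x (2 * r * tau)%N).
Proof.
case: r => [|r] rN.
  rewrite muln0 mul0n (scaffold_init sc) -[LHS](avg_cst n_gt0); congr avg.
  by apply/funext => k; rewrite (scaffold_init sc).
set c := (2 * r.+1 * tau)%N.
rewrite -[LHS](avg_cst n_gt0); congr avg.
by apply/funext => k; rewrite /c !(scaffold_sync sc).
Qed.

Lemma scaffold_still r k i : (r < N)%N -> (k <= tau)%N ->
  x (2 * r * tau + k)%N i = avg (x (2 * r * tau)%N).
Proof.
move=> rN; elim: k => [|k IH] kt; first by rewrite addn0 scaffold_start // ltnW.
by rewrite addnS (scaffold_frozen sc) // IH // ltnW.
Qed.

Lemma scaffold_step r l i : (r < N)%N -> (l.+1 < tau)%N ->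
  x (t0 r + l).+1 i = x (t0 r + l)%N i -
    eta *: (g (t0 r + l)%N i - ghat tau g r i + avg (ghat tau g r)).
Proof.
move=> rN lt; rewrite /local_start -addnA; apply: (scaffold_local sc) => //.
lia.
Qed.

Lemma scaffold_avg_step r l : (r < N)%N -> (l < tau)%N ->
  avg (x (t0 r + l).+1) = avg (x (t0 r + l)%N) - eta *: avg (g (t0 r + l)%N).
Proof.
move=> rN.
have step l' : (l'.+1 < tau)%N ->
    avg (x (t0 r + l').+1) = avg (x (t0 r + l')%N) - eta *: avg (g (t0 r + l')%N).
  move=> lt; transitivity (avg (fun i => x (t0 r + l')%N i -
    eta *: (g (t0 r + l')%N i - ghat tau g r i + avg (ghat tau g r)))).
    by congr avg; apply/funext => i; rewrite scaffold_step.
  by rewrite avgB avgZ avgD avgB avg_cst // subrK.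
rewrite leq_eqVlt => /orP[/eqP lt|]; last exact: step.
have tele l' : (l' < tau)%N -> avg (x (t0 r + l')%N) =
    avg (x (2 * r * tau)%N) - eta *: \sum_(0 <= k < l') avg (g (t0 r + k)%N).
  elim: l' => [|l' IH] l't.
    rewrite big_nil scaler0 subr0 addn0.
    rewrite -[RHS](avg_cst n_gt0); congr avg; apply/funext => i.
    by rewrite scaffold_still.
  rewrite addnS step // IH ?(ltnW l't) // big_nat_recr //= scalerDr opprD addrA.
  by [].
have lt' : (l < tau)%N by rewrite -lt.
have -> : (t0 r + l).+1 = (2 * r.+1 * tau)%N by have := round_end tau r; lia.
transitivity (avg (x (2 * r * tau)%N) -
    eta *: \sum_(0 <= k < tau) avg (g (t0 r + k)%N)).
  rewrite -[RHS](avg_cst n_gt0); congr avg; apply/funext => i.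
  rewrite (scaffold_sync sc) //; congr (_ - _).
  rewrite -scalerA; congr (_ *: _).
  rewrite exchange_big /= scaler_sumr mul2n -addnn -{1}(add0n tau) big_addn addnK.
  by apply: eq_bigr => k _; rewrite /avg /local_start addnAC addnA.
rewrite tele // -lt big_nat_recr //= scalerDr opprD addrA.
by [].
Qed.

End Trajectory.

(** A linear class of maps that contains the starting point, and contains the
    stochastic gradient taken at any of its members before time [s], contains
    all iterates up to time [s]. *)
Lemma scaffold_closed {R : realType} {n d tau N : nat} (eta : R) (x0 : 'rV[R]_d)
    (W : Type) (x g : nat -> 'I_n -> W -> 'rV[R]_d)
    (Q : (W -> 'rV[R]_d) -> Prop) :
  (1 < tau)%N ->
  (forall w, scaffold tau N eta x0 (fun t i => x t i w) (fun t i => g t i w)) ->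
  (forall v, Q (fun=> v)) ->
  (forall u v, Q u -> Q v -> Q (fun w => u w + v w)) ->
  (forall c v, Q v -> Q (fun w => c *: v w)) ->
  forall s, (s <= 2 * N * tau)%N ->
  (forall t i, (t < s)%N -> Q (x t i) -> Q (g t i)) ->
  forall i, Q (x s i).
Proof.
move=> tau1 sc Qc QD QZ.
have Qsum (I : Type) (r : seq I) (V : I -> W -> 'rV[R]_d) :
    (forall k, Q (V k)) -> Q (fun w => \sum_(k <- r) V k w).
  move=> QV; elim: r => [|k r IH].
    by under eq_fun do rewrite big_nil; exact: Qc.
  by under eq_fun do rewrite big_cons; exact: QD.
have QB u v : Q u -> Q v -> Q (fun w => u w - v w).
  move=> Qu Qv; apply: (QD) => //.
  by under eq_fun do rewrite -scaleN1r; exact: QZ.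
elim/ltn_ind => -[|s] IH sT Qg i.
  suff -> : x 0%N i = (fun=> x0) by exact: Qc.
  by apply/funext => w; exact: (scaffold_init (sc w)).
have Qx t k : (t <= s)%N -> Q (x t k).
  move=> ts; apply: IH => //; first by rewrite (leq_trans ts) // ltnW.
  by move=> t' k' t't; apply: (Qg); rewrite ltnS (leq_trans (ltnW t't)).
have Qgs t k : (t <= s)%N -> Q (g t k).
  by move=> ts; apply: (Qg); rewrite ?ltnS //; exact: Qx.
have tau2 : (0 < 2 * tau)%N by lia.
have es := divn_eq s (2 * tau); set r := (s %/ (2 * tau))%N in es.
set k := (s %% (2 * tau))%N in es.
have kt : (k < 2 * tau)%N by rewrite ltn_mod.
have rN : (r < N)%N.
  by rewrite ltn_divLR //; lia.
have {}es : s = (2 * r * tau + k)%N by lia.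
have Qghat j : (tau <= k)%N -> Q (fun w => ghat tau (fun t i => g t i w) r j).
  move=> tk; apply: (QZ).
  under eq_fun do rewrite big_mkord.
  by apply: (Qsum) => l; apply: (Qgs); have := ltn_ord l; lia.
have [kt1|kt1] := ltnP k tau.
  suff -> : x s.+1 i = x s i by exact: Qx.
  by apply/funext => w; rewrite es; exact: (scaffold_frozen (sc w)).
have [kt2|kt2] := leqP k (2 * tau - 2).
  pose gh j w := ghat tau (fun t i => g t i w) r j.
  suff -> : x s.+1 i = (fun w => x s i w -
      eta *: (g s i w - gh i w + avg (fun j => gh j w))).
    apply: (QB); first exact: Qx.
    apply: (QZ); apply: (QD); last by apply: (QZ); apply: (Qsum) => j; exact: Qghat.
    by apply: (QB); [exact: Qgs|exact: Qghat].
  by apply/funext => w; rewrite es; apply: (scaffold_local (sc w)); rewrite ?kt1.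
have es1 : s.+1 = (2 * r.+1 * tau)%N by lia.
have -> : x s.+1 i = (fun w => avg (fun j => x (2 * r * tau)%N j w) -
    (eta / n%:R) *: \sum_(j < n) \sum_(tau <= l < 2 * tau)
      g (2 * r * tau + l)%N j w).
  by apply/funext => w; rewrite es1; exact: (scaffold_sync (sc w)).
apply: (QB); first by apply: (QZ); apply: (Qsum) => j; apply: (Qx); lia.
apply: (QZ); apply: (Qsum) => j.
under eq_fun do rewrite -{1}(add0n tau) big_addn big_mkord.
by apply: (Qsum) => l; apply: (Qgs); have := ltn_ord l; lia.
Qed.

(** * Recursions for one communication round *)

Section RealRecursions.
Context {R : realType}.

Lemma pow_invn_le4 (n : nat) : (0 < n)%N -> (1 + n%:R^-1) ^+ n <= 4 :> R.
Proof.
move=> n0; have nR : 0 < n%:R :> R by rewrite ltr0n.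
have e4 : expR 1 <= 4 :> R.
  have h : 2^-1 <= expR (- 2^-1) :> R.
    by apply: le_trans (expR_ge1Dx _); lra.
  have h2 : expR 2^-1 <= 2 :> R.
    by rewrite -[leRHS]invrK -[leLHS]invrK -expRN lef_pV2 ?posrE ?invr_gt0 ?expR_gt0.
  have -> : expR 1 = expR 2^-1 ^+ 2 :> R by rewrite -expRM_natl divff.
  by have := expR_ge0 (2^-1 : R); nra.
apply: le_trans e4.
have -> : expR 1 = expR n%:R^-1 ^+ n :> R by rewrite -expRM_natl divff ?gt_eqF.
by rewrite lerXn2r ?nnegrE ?expR_ge0 ?expR_ge1Dx // addr_ge0 ?invr_ge0 ?ltW.
Qed.

(** Discrete Gronwall inequality. *)
Lemma gronwall (q : R) (a b : nat -> R) (T : nat) : 1 <= q ->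
  (forall l, (l < T)%N -> 0 <= b l) -> a 0%N <= 0 ->
  (forall l, (l < T)%N -> a l.+1 <= q * a l + b l) ->
  forall l, (l <= T)%N -> a l <= q ^+ l * \sum_(0 <= k < l) b k.
Proof.
move=> q1 b0 a0 rec; elim=> [|l IH] lT; first by rewrite big_nil mulr0.
have q0 : 0 <= q by apply: le_trans q1.
apply: le_trans (rec l lT) _; rewrite big_nat_recr //= mulrDr exprS -mulrA.
rewrite lerD ?ler_wpM2l ?IH ?(ltnW lT) //.
by rewrite ler_peMl ?b0 // -exprS exprn_ege1.
Qed.

Lemma gronwall_le (q K B : R) (a b : nat -> R) (T : nat) : 1 <= q ->
  q ^+ T <= K ->
  (forall l, (l < T)%N -> 0 <= b l) -> a 0%N <= 0 ->
  (forall l, (l < T)%N -> a l.+1 <= q * a l + b l) ->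
  \sum_(0 <= k < T) b k <= B ->
  forall l, (l <= T)%N -> a l <= K * B.
Proof.
move=> q1 qK b0 a0 rec sB l lT.
apply: le_trans (gronwall q1 b0 a0 rec lT) _.
have sT : \sum_(0 <= k < l) b k <= \sum_(0 <= k < T) b k.
  rewrite (big_cat_nat (leq0n l) lT) /= lerDl big_nat sumr_ge0 // => k /andP[_ kT].
  exact: b0.
have s0 : 0 <= \sum_(0 <= k < l) b k.
  rewrite big_nat sumr_ge0 // => k /andP[_ kl]; apply: b0.
  exact: leq_trans kl lT.
have qq : 0 <= q ^+ l by rewrite exprn_ge0 // (le_trans _ q1).
apply: ler_pM => //; last exact: le_trans sT sB.
by apply: le_trans qK; rewrite ler_weXn2l.
Qed.

Lemma sumr_const_nat_le (T : nat) (a : nat -> R) (B : R) :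
  (forall l, (l < T)%N -> a l <= B) -> \sum_(0 <= k < T) a k <= T%:R * B.
Proof.
move=> aB; rewrite big_nat; apply: le_trans (_ : \sum_(0 <= k < T) B <= _).
  by rewrite [leRHS]big_nat; apply: ler_sum => k /andP[_ kT]; exact: aB.
by rewrite sumr_const_nat subn0 -[leLHS]mulr_natl.
Qed.

(** Descent over a round of [tau] local steps. Here [D l] and [X l] stand for the
    expected squared drift and consensus distance after [l] local steps, [m l] and
    [g l] for the expected squared norms of the averaged local gradient and of the
    gradient at the average, [F l] for the expected function value, and [s] for the
    variance bound. The bias caused by the drift is of order
    [eta * (eta * tau * sqrt (db * delta)) ^ 4] times the sum of the [m l], which
    the terms [- eta / 4 * m l] compensate. *)
Lemma round_descent (tau : nat) (n L eta delta db rho s : R)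
    (D X m g F : nat -> R) :
  (1 <= tau)%N -> 0 < n -> 0 < L -> 0 < eta -> 0 <= s ->
  0 <= delta <= L -> 0 <= db <= 2 * L -> 0 <= rho ->
  eta * tau%:R * rho <= 1 -> eta * tau%:R * Num.sqrt (db * delta) <= 12^-1 ->
  (forall l, 0 <= m l) ->
  D 0%N <= 0 -> X 0%N <= 0 -> (forall l, 0 <= D l) ->
  (forall l, (l < tau)%N -> D l.+1 <= (1 + tau%:R^-1) * D l +
     ((1 + tau%:R) * eta ^+ 2 * m l + eta ^+ 2 * s / n)) ->
  (forall l, (l.+1 < tau)%N ->
     X l.+1 <= (1 + tau%:R^-1) * (1 + eta * rho) ^+ 2 * X l +
     (2 * (1 + tau%:R) * eta ^+ 2 * (delta ^+ 2 * D l + s / tau%:R)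
      + eta ^+ 2 * s)) ->
  (forall l, (l < tau)%N -> F l.+1 <= F l - eta / 2 * g l - eta / 4 * m l
     + 2 * eta * db ^+ 2 * X l + L * eta ^+ 2 * s / (2 * n)) ->
  F tau <= F 0%N - eta / 2 * (\sum_(0 <= l < tau) g l)
     + 4 * tau%:R * L * eta ^+ 2 * s / n
     + 640 * eta ^+ 3 * db ^+ 2 * tau%:R ^+ 2 * s.
Proof.
move=> tau1 n0 L0 eta0 s0 /andP[d0 dL] /andP[db0 dbL] rho0 etarho etaS m0 D0 X0 Dge0
  recD recX recF.
set t : R := tau%:R in etarho etaS recD recX recF *.
have t1 : 1 <= t by rewrite ler1n.
have t0 : 0 < t by lra.
pose M := \sum_(0 <= l < tau) m l.
have M0 : 0 <= M by apply: sumr_ge0.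
have e2 : 0 <= eta ^+ 2 by rewrite sqr_ge0.
have sn0 : 0 <= s / n by rewrite divr_ge0 // ltW.
pose DB := 4 * (2 * t * eta ^+ 2 * M + t * (eta ^+ 2 * s / n)).
have tV0 : 0 <= t^-1 by rewrite invr_ge0 ltW.
have DBle l : (l <= tau)%N -> D l <= DB.
  apply: (gronwall_le _ _ _ D0 recD).
  - by rewrite lerDl.
  - exact: pow_invn_le4.
  - move=> k _; apply: addr_ge0; last by rewrite -mulrA mulr_ge0.
    by apply: mulr_ge0 => //; apply: mulr_ge0 => //; lra.
  - rewrite big_split /= sumr_const_nat subn0 -[_ *+ tau]mulr_natl lerD2r.
    rewrite -mulr_sumr -/M ler_wpM2r // ler_wpM2r //; lra.
pose XB := 64 * (t * (4 * t * eta ^+ 2 * delta ^+ 2 * DB + 5 * eta ^+ 2 * s)).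
have DB0 : 0 <= DB by apply: le_trans (Dge0 0%N) (DBle 0%N _).
have XBle l : (l < tau)%N -> X l <= XB.
  move=> ltau; have lt1 : (l <= tau.-1)%N by rewrite -ltnS prednK.
  apply: (gronwall_le (q := (1 + t^-1) * (1 + eta * rho) ^+ 2)
    (b := fun l => 2 * (1 + t) * eta ^+ 2 * (delta ^+ 2 * D l + s / t) + eta ^+ 2 * s)
    _ _ _ X0 _ _ lt1).
  - have h1 : 1 <= (1 + eta * rho) ^+ 2.
      by rewrite exprn_ege1 // lerDl mulr_ge0 // ltW.
    by rewrite mulr_ege1 // lerDl.
  - (* [eta rho <= 1 / tau], so the rate is at most [(1 + 1 / tau) ^ 3] *)
    have er : 1 + eta * rho <= 1 + t^-1.
      by rewrite lerD2l -(ler_pM2l t0) mulfV ?gt_eqF // mulrCA mulrA.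
    have er0 : 0 <= 1 + eta * rho by rewrite addr_ge0 // mulr_ge0 // ltW.
    have q3 : (1 + t^-1) * (1 + eta * rho) ^+ 2 <= (1 + t^-1) ^+ 3.
      by rewrite [leRHS]exprS ler_wpM2l ?addr_ge0 // lerXn2r ?nnegrE ?er0 ?addr_ge0.
    apply: (@le_trans _ _ (((1 + t^-1) ^+ 3) ^+ tau)).
      apply: (@le_trans _ _ (((1 + t^-1) * (1 + eta * rho) ^+ 2) ^+ tau)).
        rewrite ler_weXn2l ?leq_pred //.
        have h1 : 1 <= (1 + eta * rho) ^+ 2.
          by rewrite exprn_ege1 // lerDl mulr_ge0 // ltW.
        by rewrite mulr_ege1 // lerDl.
      have q0 : 0 <= (1 + t^-1) * (1 + eta * rho) ^+ 2.
        by rewrite mulr_ge0 ?sqr_ge0 ?addr_ge0.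
      by apply: lerXn2r; rewrite ?nnegrE // exprn_ge0 ?addr_ge0.
    rewrite -exprM mulnC exprM (_ : 64 = 4 ^+ 3); last by rewrite -natrX.
    apply: lerXn2r; rewrite ?nnegrE ?exprn_ge0 ?addr_ge0 //.
    exact: pow_invn_le4.
  - move=> k _; have := Dge0 k => Dk.
    apply: addr_ge0; last by rewrite mulr_ge0.
    apply: mulr_ge0; first by apply: mulr_ge0 => //; lra.
    by apply: addr_ge0; [rewrite mulr_ge0 ?sqr_ge0|rewrite divr_ge0 ?(ltW t0)].
  - by move=> k kt; apply: recX; rewrite -[tau]prednK.
  - apply: (@le_trans _ _ (tau.-1%:R * (4 * t * eta ^+ 2 * delta ^+ 2 * DB
      + 5 * eta ^+ 2 * s))).
      apply: sumr_const_nat_le => k kt.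
      have kt' : (k <= tau)%N by rewrite (leq_trans (ltnW kt)) // leq_pred.
      have h1 : 2 * (1 + t) * eta ^+ 2 * (delta ^+ 2 * D k + s / t) =
        2 * (1 + t) * (eta ^+ 2 * (delta ^+ 2 * D k)) + 2 * (1 + t) / t * (eta ^+ 2 * s).
        by field; rewrite gt_eqF.
      have h2 : 2 * (1 + t) / t <= 4 by rewrite ler_pdivrMr //; lra.
      have h3 : eta ^+ 2 * (delta ^+ 2 * D k) <= eta ^+ 2 * (delta ^+ 2 * DB).
        by rewrite ler_wpM2l // ler_wpM2l ?sqr_ge0 //; exact: DBle.
      have h4 : 0 <= eta ^+ 2 * s by rewrite mulr_ge0.
      have h5 : 0 <= eta ^+ 2 * (delta ^+ 2 * D k).
        by rewrite mulr_ge0 // mulr_ge0 ?sqr_ge0.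
      have h6 := ler_wpM2r h4 h2.
      have h7 : 2 * (1 + t) * (eta ^+ 2 * (delta ^+ 2 * D k)) <=
        4 * t * (eta ^+ 2 * (delta ^+ 2 * DB)).
        by apply: ler_pM => //; lra.
      rewrite h1; lra.
    rewrite ler_wpM2r ?ler_nat ?leq_pred //.
    by apply: addr_ge0; do ![apply: mulr_ge0; rewrite ?sqr_ge0 ?(ltW t0) //].
have sX : \sum_(0 <= l < tau) X l <= t * XB by exact: sumr_const_nat_le.
have sF : F tau - F 0%N <= - (eta / 2) * (\sum_(0 <= l < tau) g l) - eta / 4 * M
    + 2 * eta * db ^+ 2 * (\sum_(0 <= l < tau) X l) + t * (L * eta ^+ 2 * s / (2 * n)).
  rewrite -(telescope_sumr F (leq0n tau)) /M !mulr_sumr.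
  have -> : t * (L * eta ^+ 2 * s / (2 * n)) =
      \sum_(0 <= l < tau) (L * eta ^+ 2 * s / (2 * n)).
    by rewrite sumr_const_nat subn0 [LHS]mulr_natl.
  rewrite -sumrB -!big_split /=; apply: ler_sum_nat => l /andP[_ lt].
  by have := recF l lt; lra.
set u := eta * t * Num.sqrt (db * delta) in etaS.
have u0 : 0 <= u by rewrite !mulr_ge0 ?sqrtr_ge0 // ltW.
have S2 : Num.sqrt (db * delta) ^+ 2 = db * delta by rewrite sqr_sqrtr ?mulr_ge0.
have SL : Num.sqrt (db * delta) <= 2 * L.
  have h : db * delta <= (2 * L) ^+ 2.
    have : db * delta <= 2 * L * L by apply: ler_pM.
    have := sqr_ge0 L; nra.
  rewrite -(ler_sqr (x := Num.sqrt _)) ?nnegrE ?sqrtr_ge0 ?mulr_ge0 ?(ltW L0) //.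
  by rewrite S2.
have u4 : u ^+ 4 = eta ^+ 4 * t ^+ 4 * (db ^+ 2 * delta ^+ 2).
  have -> : db ^+ 2 * delta ^+ 2 = (db * delta) ^+ 2 by rewrite exprMn.
  by rewrite -S2 /u; ring.
have u2 : u ^+ 2 <= 144^-1 by nra.
have u4a : u ^+ 4 <= (144 * 144)^-1.
  have -> : u ^+ 4 = u ^+ 2 * u ^+ 2 by ring.
  by have := sqr_ge0 u; nra.
have u4b : u ^+ 4 <= 1728^-1 * u.
  have h := ler_wpM2r u0 u2.
  have : u ^+ 4 = u ^+ 2 * u * u by ring.
  have := ler_wpM2r u0 h; have := ler_wpM2l u0 etaS; nra.
(* the part of the bias that the descent absorbs, the part due to the noise of
   the average, and the part due to the local noise *)
have bias : 2 * eta * db ^+ 2 * (t * XB) =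
    4096 * eta * u ^+ 4 * M + 2048 * eta * u ^+ 4 * (s / n)
    + 640 * eta ^+ 3 * db ^+ 2 * t ^+ 2 * s.
  by rewrite u4 /XB /DB; field; rewrite gt_eqF.
have b1 : 4096 * eta * u ^+ 4 * M <= eta / 4 * M.
  apply: ler_wpM2r => //.
  by move: (ltW eta0) (ler_wpM2l (ltW eta0) u4a); clear; lra.
have b2 : 2048 * eta * u ^+ 4 * (s / n) <= 3 * t * L * eta ^+ 2 * (s / n).
  apply: ler_wpM2r => //.
  have : u <= eta * t * (2 * L) by rewrite ler_wpM2l // mulr_ge0 // ltW.
  have c0 : 0 <= 1728^-1 :> R by rewrite invr_ge0 ler0n.
  move=> uL; have := ler_wpM2l (ltW eta0) (le_trans u4b (ler_wpM2l c0 uL)).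
  have w0 : 0 <= t * L * eta ^+ 2 by rewrite mulr_ge0 // mulr_ge0 ?(ltW t0) ?(ltW L0).
  by move: w0; clear; lra.
have b3 : t * (L * eta ^+ 2 * s / (2 * n)) = 2^-1 * (t * L * eta ^+ 2 * (s / n)).
  by field; rewrite gt_eqF.
have b4 : 0 <= t * L * eta ^+ 2 * (s / n).
  by rewrite mulr_ge0 // mulr_ge0 // mulr_ge0 ?(ltW t0) ?(ltW L0).
have b5 : 2 * eta * db ^+ 2 * (\sum_(0 <= l < tau) X l) <= 2 * eta * db ^+ 2 * (t * XB).
  by rewrite ler_wpM2l // mulr_ge0 ?sqr_ge0 // mulr_ge0 // ltW.
have -> : 4 * t * L * eta ^+ 2 * s / n = 4 * (t * L * eta ^+ 2 * (s / n)).
  by field; rewrite gt_eqF.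
by move: sF b5 b1 b2 b4; rewrite bias b3; clear; lra.
Qed.

End RealRecursions.

(** * Expected progress of the algorithm *)

Section Expectations.
Context {R : realType} {n d tau N : nat} {dO dX : measure_display}
  {Omega : measurableType dO} {Xi : measurableType dX}.
Context (L sigma eta : R) (x0 : 'rV[R]_d) (f : 'I_n -> 'rV[R]_d -> R)
  (P : probability Omega R) (xi : nat -> 'I_n -> {RV P >-> Xi})
  (G : 'I_n -> 'rV[R]_d -> Xi -> 'rV[R]_d)
  (x : nat -> 'I_n -> Omega -> 'rV[R]_d).
Local Notation T := (2 * N * tau)%N.
Context (n_gt0 : (0 < n)%N) (tau_gt1 : (1 < tau)%N).
Context (df : forall i y, differentiable (f i) y).
Context (lip : forall i y z,
  l2norm (grad (f i) y - grad (f i) z) <= L * l2norm (y - z)).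
Context (mG : forall i, measurable_fun [set: borel_rV R d * Xi]
       (fun p : borel_rV R d * Xi => G i p.1 p.2 : borel_rV R d)).
Context (indep : mutually_independent P
  (fun p : 'I_T * 'I_n => xi p.1 p.2 : Omega -> Xi)).
Context (oracle : forall t i, (t < T)%N ->
       stochastic_oracle P (f i) sigma (G i) (xi t i)).
Context (sc : forall w, scaffold tau N eta x0 (fun t i => x t i w)
         (fun t i => G i (x t i w) (xi t i w))).

Let X (p : 'I_T * 'I_n) : {mfun Omega >-> Xi} := xi p.1 p.2.

Let g t i w := G i (x t i w) (xi t i w).

(** The noise received by worker [i] at time [t]. *)
Definition noise t i w := G i (x t i w) (xi t i w) - grad (f i) (x t i w).

(** The samples that are drawn before time [t], or at time [t] by the workers
    other than [i]. *)
Definition others t i : {set 'I_T * 'I_n} :=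
  [set p : 'I_T * 'I_n | (p.1 < t)%N || ((p.1 == t :> nat) && (p.2 != i))]%SET.

Let mv (J : {set 'I_T * 'I_n}) (V : Omega -> 'rV[R]_d) :=
  measurable_fun [set: past X J] (V : past X J -> borel_rV R d).

Let mv_grad (J : {set 'I_T * 'I_n}) i V : mv J V -> mv J (fun w => grad (f i) (V w)).
Proof.
move=> mV; have mg := lipschitz_measurable (lip i).
exact: (measurableT_comp mg mV).
Qed.

Let mv_g (J : {set 'I_T * 'I_n}) t i (tT : (t < T)%N) :
  (Ordinal tT, i) \in J -> mv J (x t i) ->
  mv J (g t i).
Proof.
move=> tJ mx; have mX := @measurable_past _ _ _ _ _ X J _ tJ.
have mp : measurable_fun [set: past X J]
    (fun w => (x t i w, xi t i w) : borel_rV R d * Xi).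
  exact: measurable_fun_pair.
exact: (measurableT_comp (mG i) mp).
Qed.

Let mv_x (J : {set 'I_T * 'I_n}) s : (s <= T)%N ->
  (forall p : 'I_T * 'I_n, (p.1 < s)%N -> p \in J) ->
  forall i, mv J (x s i).
Proof.
move=> sT sJ i; apply: (scaffold_closed (Q := mv J) tau_gt1 sc) => //.
- by move=> v; exact: measurable_cst.
- by move=> u v; exact: measurable_rVD.
- by move=> c v; exact: measurable_rVZ.
- move=> t k ts; have tT := leq_trans ts sT.
  by apply: (mv_g (tT := tT)); apply: sJ.
Qed.

Lemma others_notin t i (tT : (t < T)%N) : (Ordinal tT, i) \notin others t i.
Proof. by rewrite inE /= ltnn !eqxx. Qed.

Let mv_x_others s t i k : (s <= t)%N -> (t < T)%N -> mv (others t i) (x s k).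
Proof.
move=> st tT; apply: mv_x; first by rewrite (leq_trans st) // ltnW.
by move=> p ps; rewrite inE (leq_trans ps st).
Qed.

Lemma L2v_grad i V : L2v P V -> L2v P (fun w => grad (f i) (V w)).
Proof. exact: (L2v_lip (lip i) (lipschitz_measurable (lip i))). Qed.

Lemma noise_sq_integrable t i : (t < T)%N -> L2v P (noise t i).
Proof.
move=> tT; apply: (noise_L2v (X := X) (J := others t i) (q := (Ordinal tT, i))
  indep (lip i) (mG i)).
- exact: others_notin.
- exact: oracle.
- exact: mv_x_others.
Qed.

Lemma noise_variance t i : (t < T)%N -> nrm2 P (noise t i) <= sigma ^+ 2.
Proof.
move=> tT; apply: (noise_nrm2 (X := X) (J := others t i) (q := (Ordinal tT, i))
  indep (lip i) (mG i)).
- exact: others_notin.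
- exact: oracle.
- exact: mv_x_others.
Qed.

Lemma L2v_x s i : (s <= T)%N -> L2v P (x s i).
Proof.
move=> sT; apply: (scaffold_closed (Q := L2v P) tau_gt1 sc) => //.
- exact: L2v_cst.
- exact: L2vD.
- exact: L2vZ.
- move=> t k ts Lx; have tT := leq_trans ts sT.
  have -> : (fun w => G k (x t k w) (xi t k w)) =
      (fun w => noise t k w + grad (f k) (x t k w)).
    by apply/funext => w; rewrite subrK.
  by apply: L2vD; [exact: noise_sq_integrable|exact: L2v_grad].
Qed.

(** Square-integrable vectors that do not depend on the sample of worker [i] at
    time [t], nor on any later one. *)
Definition adapted t i V :=
  L2v P V /\ measurable_fun [set: past X (others t i)]
    (V : past X (others t i) -> borel_rV R d).

Lemma adapted_L2v t i V : adapted t i V -> L2v P V. Proof. by case. Qed.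

Lemma adapted_cst t i v : adapted t i (fun=> v).
Proof. by split; [exact: L2v_cst|exact: measurable_cst]. Qed.

Lemma adaptedD t i V W : adapted t i V -> adapted t i W ->
  adapted t i (fun w => V w + W w).
Proof. by move=> [? ?] [? ?]; split; [exact: L2vD|exact: measurable_rVD]. Qed.

Lemma adaptedZ t i c V : adapted t i V -> adapted t i (fun w => c *: V w).
Proof. by move=> [? ?]; split; [exact: L2vZ|exact: measurable_rVZ]. Qed.

Lemma adaptedB t i V W : adapted t i V -> adapted t i W ->
  adapted t i (fun w => V w - W w).
Proof.
move=> aV aW; apply: adaptedD => //.
by under eq_fun do rewrite -scaleN1r; exact: adaptedZ.
Qed.

Lemma adapted_sum t i (I : Type) (s : seq I) (V : I -> Omega -> 'rV[R]_d) :
  (forall k, adapted t i (V k)) -> adapted t i (fun w => \sum_(k <- s) V k w).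
Proof.
move=> aV; elim: s => [|k s IH].
  by under eq_fun do rewrite big_nil; exact: adapted_cst.
by under eq_fun do rewrite big_cons; exact: adaptedD.
Qed.

Lemma adapted_avg t i (V : 'I_n -> Omega -> 'rV[R]_d) :
  (forall k, adapted t i (V k)) -> adapted t i (fun w => avg (fun k => V k w)).
Proof. by move=> aV; apply: adaptedZ; exact: adapted_sum. Qed.

Lemma adapted_grad t i k V : adapted t i V ->
  adapted t i (fun w => grad (f k) (V w)).
Proof. by move=> [? ?]; split; [exact: L2v_grad|exact: mv_grad]. Qed.

Lemma adapted_grad_favg t i V : adapted t i V ->
  adapted t i (fun w => grad (favg f) (V w)).
Proof.
move=> aV; under eq_fun do rewrite grad_favg //.
by apply: adapted_avg => k; exact: adapted_grad.
Qed.

Lemma adapted_x t i s k : (s <= t)%N -> (t < T)%N -> adapted t i (x s k).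
Proof.
move=> st tT; split; last exact: mv_x_others.
by apply: L2v_x; rewrite (leq_trans st) // ltnW.
Qed.

Lemma adapted_noise t i s k : (t < T)%N -> (s < t)%N || (s == t) && (k != i) ->
  adapted t i (noise s k).
Proof.
move=> tT stk; have st : (s <= t)%N by case/orP: stk => [/ltnW//|/andP[/eqP ->]].
have sT := leq_ltn_trans st tT.
split; first exact: noise_sq_integrable.
apply: measurable_rVD.
  by apply: (mv_g (tT := sT)); [rewrite inE|exact: mv_x_others].
under eq_fun do rewrite -scaleN1r.
by apply: measurable_rVZ; apply: mv_grad; exact: mv_x_others.
Qed.

Lemma adapted_orth t i V : (t < T)%N -> adapted t i V ->
  Ex P (fun w => dotv (V w) (noise t i w)) = 0.
Proof.
move=> tT [lV mV].
apply: (noise_orth (X := X) (J := others t i) (q := (Ordinal tT, i))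
  indep (lip i) (mG i)) => //.
- exact: others_notin.
- exact: oracle.
- exact: mv_x_others.
Qed.

Lemma noise_avg_orth t V : (t < T)%N -> (forall i, adapted t i V) ->
  Ex P (fun w => dotv (V w) (avg (fun i => noise t i w))) = 0.
Proof.
move=> tT aV; have lV : L2v P V by case: (aV (Ordinal n_gt0)).
rewrite /avg; under eq_fun do rewrite dotvZr.
rewrite ExZ; last first.
  by apply: itg_dotv => //; apply: L2v_sum => i _; exact: noise_sq_integrable.
rewrite Ex_dotv_sumr => [|i _|//]; last exact: noise_sq_integrable.
by rewrite big1 ?mulr0 // => i _; exact: adapted_orth.
Qed.

(** The noises of the [n] workers at time [t] are pairwise orthogonal, so averaging
    them divides the variance by [n]. *)
Lemma noise_avg_variance t : (t < T)%N ->
  nrm2 P (fun w => avg (fun i => noise t i w)) <= sigma ^+ 2 / n%:R.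
Proof.
move=> tT; have nR : 0 < n%:R :> R by rewrite ltr0n.
have Ls : L2v P (fun w => \sum_(i < n) noise t i w).
  by apply: L2v_sum => i _; exact: noise_sq_integrable.
rewrite nrm2Z // [leRHS](_ : _ = n%:R^-1 ^+ 2 * (n%:R * sigma ^+ 2)).
  rewrite ler_wpM2l ?sqr_ge0 //.
  rewrite -[X in X%:R](card_ord n) cardT.
  have := @nrm2_sum_orth _ _ _ P d _ (index_enum 'I_n) (noise t) (sigma ^+ 2).
  rewrite [index_enum _]unlock -enumT; apply.
  - exact: enum_uniq.
  - by move=> i _; exact: noise_sq_integrable.
  - by move=> i _; exact: noise_variance.
  - move=> i k _ _ ik; apply: adapted_orth => //.
    by apply: adapted_noise => //; rewrite eqxx ik orbT.
by field; rewrite gt_eqF.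
Qed.

(** The successive noises of one worker are pairwise orthogonal, so averaging
    [tau] of them divides the variance by [tau]. *)
Lemma noise_mean_variance s i : (s + tau <= T)%N ->
  nrm2 P (fun w => tau%:R^-1 *: \sum_(0 <= k < tau) noise (s + k)%N i w)
    <= sigma ^+ 2 / tau%:R.
Proof.
move=> sT; have tR : 0 < tau%:R :> R by rewrite ltr0n ltnW.
have kT k : k \in index_iota 0 tau -> (s + k < T)%N.
  by rewrite mem_index_iota => /andP[_ kt]; apply: leq_trans sT; rewrite ltn_add2l.
have Ls : L2v P (fun w => \sum_(0 <= k < tau) noise (s + k)%N i w).
  under eq_fun do rewrite big_seq.
  by apply: L2v_sum => k kt; apply: noise_sq_integrable; exact: kT.
rewrite nrm2Z // [leRHS](_ : _ = tau%:R^-1 ^+ 2 * (tau%:R * sigma ^+ 2)).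
  rewrite ler_wpM2l ?sqr_ge0 //.
  have := @nrm2_sum_orth _ _ _ P d _ (index_iota 0 tau)
    (fun k => noise (s + k)%N i) (sigma ^+ 2).
  rewrite size_iota subn0; apply.
  - exact: iota_uniq.
  - by move=> k kt; apply: noise_sq_integrable; exact: kT.
  - by move=> k kt; apply: noise_variance; exact: kT.
  - move=> k l kt lt kl.
    have [kl'|kl'] := ltnP k l.
      apply: adapted_orth; first exact: kT.
      by apply: adapted_noise; rewrite ?ltn_add2l ?kl' //; exact: kT.
    under eq_fun do rewrite dotvC.
    apply: adapted_orth; first exact: kT.
    have lk : (l < k)%N by rewrite ltn_neqAle eq_sym kl.
    by apply: adapted_noise; rewrite ?ltn_add2l ?lk //; exact: kT.
by field; rewrite gt_eqF.
Qed.

Context (delta db rho : R) (L_gt0 : 0 < L) (delta_ge0 : 0 <= delta)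
  (db_ge0 : 0 <= db) (rho_ge0 : 0 <= rho) (eta_gt0 : 0 < eta).
Context (flb : has_lbound (range (favg f))).
Context (stdsim : forall y z,
  n%:R^-1 * (\sum_(i < n) l2norm (grad (f i) y - grad (favg f) y
                             - grad (f i) z + grad (favg f) z) ^+ 2)
    <= delta ^+ 2 * l2norm (y - z) ^+ 2).
Context (unif : forall i y z,
  l2norm (grad (f i) y - grad (favg f) y - grad (f i) z + grad (favg f) z)
    <= db * l2norm (y - z)).
Context (wcvx : forall i, convex_function [set: 'rV[R]_d]
       (fun y => f i y + rho / 2 * (y *m y^T) 0 0)).
Context (a : 'I_n -> R) (a_ge0 : forall i, 0 <= a i)
  (a_sum1 : \sum_(i < n) a i = 1)
  (hess : constant_hessian (convex_comb a f)).

(** The average of the iterates. *)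
Definition xbar t w := avg (fun i => x t i w).

Lemma L2v_xbar t : (t <= T)%N -> L2v P (xbar t).
Proof. by move=> tT; apply: L2v_avg => i; exact: L2v_x. Qed.

Lemma itg_favg V : L2v P V -> itg P (fun w => favg f (V w)).
Proof.
move=> lV; have dF y : differentiable (favg f) y by exact: differentiable_favg.
have [b bP] := flb.
pose B w := `|b| + (`|favg f 0| + (sqn (grad (favg f) 0) + (1 + L / 2) * sqn (V w))).
apply: (@itg_le _ _ _ _ _ B).
- have mF : measurable_fun [set: borel_rV R d] (favg f : borel_rV R d -> R).
    by apply: continuous_measurable_rV => y; exact: differentiable_continuous.
  exact: (measurableT_comp mF (L2v_rV lV)).
- move=> w; have lo : b <= favg f (V w) by apply: bP; exists (V w).
  have up := descent 0 (V w) dF (favg_lip n_gt0 L_gt0 df lip).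
  rewrite subr0 in up.
  have := dotv_abs (grad (favg f) 0) (V w).
  rewrite ler_norml => /andP[_ hd].
  have s0 := sqn_ge0 (V w); have s1 := sqn_ge0 (grad (favg f) 0).
  have n1 := ler_norm (favg f 0).
  have n2 : - `|b| <= b by rewrite lerNl -normrN ler_norm.
  have n3 := normr_ge0 b; have n4 := normr_ge0 (favg f 0).
  have s2 : 0 <= L / 2 * sqn (V w) by rewrite mulr_ge0 // divr_ge0 // ltW.
  by rewrite ler_norml /B; lra.
- do 3! (apply: itgD; first exact: itg_cst).
  by apply: itgZ; exact: itg_sqn.
Qed.

Section Round.
Context (r : nat) (rN : (r < N)%N).

Local Notation s := (local_start tau r).
Let z w := xbar (2 * r * tau)%N w.

Let sT l : (l <= tau)%N -> (s + l <= T)%N.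
Proof.
move=> lt; have h : (s + tau <= T)%N.
  by rewrite round_end leq_mul2r leq_mul2l rN !orbT.
by apply: leq_trans h; rewrite leq_add2l.
Qed.

Let sTl l : (l < tau)%N -> (s + l < T)%N.
Proof. by move=> lt; apply: leq_trans (sT lt); rewrite addnS. Qed.

Let x_still k i w : (k <= tau)%N -> x (2 * r * tau + k)%N i w = z w.
Proof. by move=> kt; exact: (scaffold_still n_gt0 (sc w) i rN kt). Qed.

Let x_start i w : x s i w = z w.
Proof. exact: x_still. Qed.

Let xbar_start w : xbar s w = z w.
Proof.
by rewrite -[RHS](avg_cst n_gt0); congr avg; apply/funext => i; exact: x_start.
Qed.

(** The averaged local gradient after [l] local steps. *)
Definition mbar l w := avg (fun i => grad (f i) (x (s + l)%N i w)).

Let xbar_step l w : (l < tau)%N -> xbar (s + l.+1)%N w =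
  xbar (s + l)%N w - eta *: (mbar l w + avg (fun i => noise (s + l)%N i w)).
Proof.
move=> lt; rewrite addnS.
have := scaffold_avg_step n_gt0 tau_gt1 (sc w) rN lt.
rewrite /xbar => ->; congr (_ - _ *: _); rewrite -avgD; congr avg.
by apply/funext => i; rewrite /noise addrC subrK.
Qed.

Let ad_x l i k : (l < tau)%N -> adapted (s + l)%N i (x (s + l)%N k).
Proof. by move=> lt; apply: adapted_x => //; exact: sTl. Qed.

Let ad_xbar l i : (l < tau)%N -> adapted (s + l)%N i (xbar (s + l)%N).
Proof. by move=> lt; apply: adapted_avg => k; exact: ad_x. Qed.

Let ad_z l i : (l < tau)%N -> adapted (s + l)%N i z.
Proof.
move=> lt; apply: adapted_avg => k; apply: adapted_x; last exact: sTl.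
by rewrite /local_start -addnA leq_addr.
Qed.

Let ad_mbar l i : (l < tau)%N -> adapted (s + l)%N i (mbar l).
Proof. by move=> lt; apply: adapted_avg => k; apply: adapted_grad; exact: ad_x. Qed.

Let i0 : 'I_n := Ordinal n_gt0.

Let L2v_mbar l : (l < tau)%N -> L2v P (mbar l).
Proof. by move=> lt; exact: adapted_L2v (ad_mbar i0 lt). Qed.

Let L2v_z : L2v P z.
Proof.
by apply: L2v_xbar; rewrite leq_mul2r leq_mul2l (ltnW rN) !orbT.
Qed.

Let L2v_nbar l : (l < tau)%N -> L2v P (fun w => avg (fun i => noise (s + l)%N i w)).
Proof.
by move=> lt; apply: L2v_avg => i; apply: noise_sq_integrable; exact: sTl.
Qed.

(** The expected squared distance between the average after [l] local steps and
    the starting point of the round. *)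
Definition drift2 l := nrm2 P (fun w => xbar (s + l)%N w - z w).

(** The expected mean squared distance of the workers to their average. *)
Definition consensus l := Ex P (fun w =>
  ravg (fun i => sqn (x (s + l)%N i w - xbar (s + l)%N w))).

(** The expected objective value at the average. *)
Definition value l := Ex P (fun w => favg f (xbar (s + l)%N w)).

Lemma drift2_0 : drift2 0 = 0.
Proof.
rewrite /drift2 /nrm2; under eq_fun do rewrite addn0 xbar_start subrr sqn0.
exact: Ex_cst.
Qed.

Lemma consensus_0 : consensus 0 = 0.
Proof.
rewrite /consensus.
have -> : (fun w => ravg (fun i => sqn (x (s + 0)%N i w - xbar (s + 0)%N w))) =
    (fun=> 0).
  apply/funext => w; rewrite -[RHS](ravg_cst n_gt0); congr ravg.
  by apply/funext => i; rewrite addn0 xbar_start x_start subrr sqn0.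
exact: Ex_cst.
Qed.

Lemma drift2_step l : (l < tau)%N ->
  drift2 l.+1 <= (1 + tau%:R^-1) * drift2 l +
    ((1 + tau%:R) * eta ^+ 2 * nrm2 P (mbar l) + eta ^+ 2 * sigma ^+ 2 / n%:R).
Proof.
move=> lt; have tR : 0 < tau%:R^-1 :> R by rewrite invr_gt0 ltr0n ltnW.
pose A w := xbar (s + l)%N w - z w - eta *: mbar l w.
pose B w := avg (fun i => noise (s + l)%N i w).
have adA i : adapted (s + l)%N i A.
  apply: adaptedB; first by apply: adaptedB; [exact: ad_xbar|exact: ad_z].
  by apply: adaptedZ; exact: ad_mbar.
have lA : L2v P A by exact: adapted_L2v (adA i0).
have lB : L2v P B by exact: L2v_nbar.
have lxz : L2v P (fun w => xbar (s + l)%N w - z w).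
  by apply: L2vB => //; apply: L2v_xbar; exact: ltnW (sTl lt).
rewrite /drift2.
have -> : (fun w => xbar (s + l.+1)%N w - z w) = (fun w => A w + (- eta) *: B w).
  apply/funext => w; rewrite xbar_step // /A -/(B w).
  move: (xbar _ w) (z w) (mbar l w) (B w) => p1 p2 p3 p4.
  by apply/rowP => j; rewrite !mxE; ring.
rewrite nrm2D //; last exact: L2vZ.
have -> : Ex P (fun w => dotv (A w) ((- eta) *: B w)) = 0.
  under eq_fun do rewrite dotvZr.
  rewrite ExZ; last exact: itg_dotv.
  by rewrite noise_avg_orth ?mulr0 //; exact: sTl.
rewrite mulr0 addr0 nrm2Z // sqrrN addrA; apply: lerD; last first.
  by rewrite -mulrA ler_wpM2l ?sqr_ge0 //; apply: noise_avg_variance; exact: sTl.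
have im : itg P (fun w => sqn (eta *: mbar l w)).
  by apply: itg_sqn; apply: L2vZ; exact: L2v_mbar.
have ixz := itg_sqn lxz.
have path w : sqn (A w) <= (1 + tau%:R^-1) * sqn (xbar (s + l)%N w - z w) +
    (1 + tau%:R) * sqn (eta *: mbar l w).
  have -> : 1 + tau%:R = 1 + (tau%:R^-1)^-1 :> R by rewrite invrK.
  by rewrite /A -(sqnN (eta *: _)); exact: sqnD_young.
apply: le_trans (Ex_le (itg_sqn lA) (itgD (itgZ _ ixz) (itgZ _ im)) path) _.
rewrite (ExD (itgZ _ ixz) (itgZ _ im)) (ExZ _ ixz) (ExZ _ im).
by rewrite [X in _ + _ * X](nrm2Z eta (L2v_mbar lt)) mulrA.
Qed.

(** The error of the averaged gradient that worker [i] computes at [z]. *)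
Let e i w := tau%:R^-1 *: \sum_(0 <= k < tau) noise (2 * r * tau + k)%N i w.

Let ghatE i w : ghat tau (fun t i => G i (x t i w) (xi t i w)) r i =
  grad (f i) (z w) + e i w.
Proof.
have tR : tau%:R != 0 :> R by rewrite pnatr_eq0 -lt0n ltnW.
have -> : grad (f i) (z w) =
    tau%:R^-1 *: \sum_(0 <= k < tau) grad (f i) (z w).
  rewrite sumr_const_nat subn0 -[grad _ _ *+ tau]scaler_nat scalerA mulVf //.
  by rewrite scale1r.
rewrite /ghat /e -scalerDr -big_split /=; congr (_ *: _).
rewrite big_nat [RHS]big_nat; apply: eq_bigr => k /andP[_ kt].
by rewrite /noise x_still ?(ltnW kt) // addrC subrK.
Qed.

Let ad_e l i k : (l < tau)%N -> adapted (s + l)%N i (e k).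
Proof.
move=> lt; apply: adaptedZ; under eq_fun do rewrite big_mkord.
apply: adapted_sum => j; apply: adapted_noise; first exact: sTl.
by rewrite /local_start -!addnA ltn_add2l ltn_addr.
Qed.

Let nrm2_e i : nrm2 P (e i) <= sigma ^+ 2 / tau%:R.
Proof. by apply: noise_mean_variance; have := sT (leq0n _); rewrite addn0. Qed.

Let itg_consensus l : (l <= tau)%N -> itg P (fun w =>
  ravg (fun i => sqn (x (s + l)%N i w - xbar (s + l)%N w))).
Proof.
move=> lt; apply: itg_ravg => i; apply: itg_sqn; apply: L2vB.
  by apply: L2v_x; exact: sT.
by apply: L2v_xbar; exact: sT.
Qed.

(** The displacement common to all workers does not affect the consensus distance,
    and the local noise is orthogonal to the rest of the displacement. *)
Lemma consensus_step l : eta * (L + rho) <= 2 -> (l.+1 < tau)%N ->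
  consensus l.+1 <= (1 + tau%:R^-1) * (1 + eta * rho) ^+ 2 * consensus l +
    (2 * (1 + tau%:R) * eta ^+ 2 * (delta ^+ 2 * drift2 l + sigma ^+ 2 / tau%:R)
     + eta ^+ 2 * sigma ^+ 2).
Proof.
move=> etaL lt1; have lt := ltnW lt1.
have tR : 0 < tau%:R^-1 :> R by rewrite invr_gt0 ltr0n ltnW.
pose V i w := drift f eta (xbar (s + l)%N w) (z w)
  (fun i => x (s + l)%N i w) (fun i => e i w) i.
have adV i : adapted (s + l)%N i (V i).
  apply: adaptedB.
    apply: adaptedB; first by apply: adaptedB; [exact: ad_x|exact: ad_xbar].
    by apply: adaptedZ; apply: adaptedB; apply: adapted_grad;
      [exact: ad_x|exact: ad_xbar].
  apply: adaptedZ; apply: adaptedB; last exact: ad_e.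
  apply: adaptedD; last by apply: adapted_grad_favg; exact: ad_z.
  apply: adaptedB; last by apply: adapted_grad; exact: ad_z.
  by apply: adaptedB; [apply: adapted_grad|apply: adapted_grad_favg]; exact: ad_xbar.
have lV i : L2v P (V i) := adapted_L2v (adV i).
have lE i : L2v P (noise (s + l)%N i) by apply: noise_sq_integrable; exact: sTl.
have lW i : L2v P (fun w => V i w + (- eta) *: noise (s + l)%N i w).
  by apply: L2vD => //; exact: L2vZ.
have le1 : consensus l.+1 <=
    Ex P (fun w => ravg (fun i => sqn (V i w + (- eta) *: noise (s + l)%N i w))).
  apply: Ex_le; first exact: itg_consensus.
    by apply: itg_ravg => i; exact: itg_sqn.
  move=> w.
  have [y yE] := @local_step_drift _ _ _ f eta (xbar (s + l)%N w) (z w)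
    (fun i => x (s + l)%N i w) (fun i => e i w) (fun i => noise (s + l)%N i w)
    (fun i => G i (x (s + l)%N i w) (xi (s + l)%N i w))
    (fun i => ghat tau (fun t i => G i (x t i w) (xi t i w)) r i)
    (fun i => esym (etrans (addrC _ _) (subrK _ _))) (fun i => ghatE i w).
  apply: le_trans (ravg_sqnB_le n_gt0 _ y) _; apply: ler_ravg => i.
  rewrite addnS (scaffold_step n_gt0 tau_gt1 (sc w) i rN lt1) yE.
  by rewrite scaleNr.
apply: le_trans le1 _; rewrite Ex_ravg => [|i]; last exact: itg_sqn.
have le2 i : Ex P (fun w => sqn (V i w + (- eta) *: noise (s + l)%N i w)) <=
    nrm2 P (V i) + eta ^+ 2 * sigma ^+ 2.
  rewrite -/(nrm2 P _) nrm2D //; last exact: L2vZ.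
  have -> : Ex P (fun w => dotv (V i w) ((- eta) *: noise (s + l)%N i w)) = 0.
    under eq_fun do rewrite dotvZr.
    rewrite ExZ; last exact: itg_dotv.
    by rewrite adapted_orth ?mulr0 //; exact: sTl.
  rewrite mulr0 addr0 nrm2Z // sqrrN lerD2l ler_wpM2l ?sqr_ge0 //.
  by apply: noise_variance; exact: sTl.
apply: le_trans (ler_ravg le2) _; rewrite ravgD ravg_cst // addrA lerD2r.
rewrite -Ex_ravg => [|i]; last exact: itg_sqn.
have lD : L2v P (fun w => xbar (s + l)%N w - z w).
  by apply: L2vB => //; apply: L2v_xbar; exact: ltnW (sTl lt).
have ie : itg P (fun w => ravg (fun i => sqn (e i w))).
  by apply: itg_ravg => i; apply: itg_sqn; exact: adapted_L2v (ad_e i0 i lt).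
have ic := itg_consensus (ltnW lt).
have le3 := Ex_le (itg_ravg (fun i => itg_sqn (lV i))) _
  (fun w => drift_le L_gt0 rho_ge0 df lip stdsim wcvx (xbar (s + l)%N w) (z w)
     (fun i => x (s + l)%N i w) (fun i => e i w) tR eta_gt0 etaL).
apply: le_trans (le3 _) _.
  by apply: itgD; apply: itgZ => //; apply: itgD; apply: itgZ => //; apply: itgZ;
    exact: itg_sqn.
rewrite ExD; [|exact: itgZ|by apply: itgZ; apply: itgD; apply: itgZ => //;
  apply: itgZ; exact: itg_sqn].
rewrite ExZ // lerD2l ExZ; last first.
  by apply: itgD; apply: itgZ => //; apply: itgZ; exact: itg_sqn.
have iD := itg_sqn lD.
rewrite (ExD (itgZ 2 (itgZ (delta ^+ 2) iD)) (itgZ 2 ie)) (ExZ 2 ie).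
rewrite (ExZ 2 (itgZ _ iD)) (ExZ _ iD).
rewrite -/(nrm2 P _) -/(drift2 l) invrK.
have le4 : Ex P (fun w => ravg (fun i => sqn (e i w))) <= sigma ^+ 2 / tau%:R.
  rewrite Ex_ravg => [|i]; last by apply: itg_sqn; exact: adapted_L2v (ad_e i0 i lt).
  by rewrite -[leRHS](ravg_cst n_gt0); exact: ler_ravg.
have h0 : 0 <= (1 + tau%:R) * eta ^+ 2 :> R by rewrite mulr_ge0 ?sqr_ge0 ?addr_ge0.
have := ler_wpM2l h0 le4; lra.
Qed.

(** The descent inequality. Half of the term [- eta / 2 * |mbar l|^2], which comes
    from the polarization of [dotv (grad f) (mbar l)], pays for the second-order
    term of the descent lemma. *)
Lemma value_step l : eta * L <= 2^-1 -> (l < tau)%N ->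
  value l.+1 <= value l
    - eta / 2 * nrm2 P (fun w => grad (favg f) (xbar (s + l)%N w))
    - eta / 4 * nrm2 P (mbar l)
    + 2 * eta * db ^+ 2 * consensus l + L * eta ^+ 2 * sigma ^+ 2 / (2 * n%:R).
Proof.
move=> etaL lt; have dF y : differentiable (favg f) y by exact: differentiable_favg.
pose c w := xbar (s + l)%N w.
pose B w := avg (fun i => noise (s + l)%N i w).
pose H w := grad (favg f) (c w).
pose m w := mbar l w.
pose K w := ravg (fun i => sqn (x (s + l)%N i w - c w)).
have adH i : adapted (s + l)%N i H by apply: adapted_grad_favg; exact: ad_xbar.
have lH : L2v P H := adapted_L2v (adH i0).
have lm : L2v P m by exact: L2v_mbar.
have lB : L2v P B by exact: L2v_nbar.
have lc : L2v P c by apply: L2v_xbar; exact: ltnW (sTl lt).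
have path w : favg f (xbar (s + l.+1)%N w) <= favg f (c w)
    + (- (eta / 2)) * sqn (H w) + (- (eta / 4)) * sqn (m w)
    + 2 * eta * db ^+ 2 * K w + L * eta ^+ 2 / 2 * sqn (B w)
    + (- eta) * dotv (H w) (B w) + L * eta ^+ 2 * dotv (m w) (B w).
  have := descent (c w) (xbar (s + l.+1)%N w) dF (favg_lip n_gt0 L_gt0 df lip).
  have -> : xbar (s + l.+1)%N w - c w = - (eta *: (m w + B w)).
    by rewrite xbar_step // addrC addKr.
  rewrite -/(H w) dotvNr dotvZr dotvDr sqnN sqnZ sqnD => h.
  have := gradient_bias n_gt0 df unif (fun i => x (s + l)%N i w)
    a_ge0 a_sum1 hess.
  rewrite -/(c w) -/(H w) -/(m w) -/(K w) sqnB => hb.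
  have hb' := ler_wpM2l (ltW eta_gt0) hb.
  have h2 : eta * L * (eta * sqn (m w)) <= 2^-1 * (eta * sqn (m w)).
    by rewrite ler_wpM2r // mulr_ge0 ?sqn_ge0 // ltW.
  lra.
have iK : itg P K by exact: itg_consensus (ltnW lt).
have iF1 : itg P (fun w => favg f (xbar (s + l.+1)%N w)).
  by apply: itg_favg; apply: L2v_xbar; exact: sT.
have iF : itg P (fun w => favg f (c w)) by exact: itg_favg.
have iH := itg_sqn lH; have im := itg_sqn lm; have iB := itg_sqn lB.
have iHB := itg_dotv lH lB; have imB := itg_dotv lm lB.
have := Ex_le iF1 _ path; rewrite -/(value l.+1).
have j1 := itgD iF (itgZ (- (eta / 2)) iH).
have j2 := itgD j1 (itgZ (- (eta / 4)) im).
have j3 := itgD j2 (itgZ (2 * eta * db ^+ 2) iK).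
have j4 := itgD j3 (itgZ (L * eta ^+ 2 / 2) iB).
have j5 := itgD j4 (itgZ (- eta) iHB).
have j6 := itgD j5 (itgZ (L * eta ^+ 2) imB).
move=> /(_ j6).
rewrite (ExD j5 (itgZ _ imB)) (ExD j4 (itgZ _ iHB)) (ExD j3 (itgZ _ iB)).
rewrite (ExD j2 (itgZ _ iK)) (ExD j1 (itgZ _ im)) (ExD iF (itgZ _ iH)).
rewrite (ExZ _ iH) (ExZ _ im) (ExZ _ iK) (ExZ _ iB) (ExZ _ iHB) (ExZ _ imB).
have -> : Ex P (fun w => dotv (H w) (B w)) = 0.
  by apply: noise_avg_orth => //; exact: sTl.
have -> : Ex P (fun w => dotv (m w) (B w)) = 0.
  by apply: noise_avg_orth => [|i]; [exact: sTl|exact: ad_mbar].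
rewrite -/(nrm2 P H) -/(nrm2 P m) -/(nrm2 P B) -/(consensus l) -/(value l) => h.
have := noise_avg_variance (sTl lt); rewrite -/B => hB.
have L2 : 0 <= L * eta ^+ 2 / 2 by rewrite divr_ge0 // mulr_ge0 ?sqr_ge0 // ltW.
have hB' := ler_wpM2l L2 hB.
have E : L * eta ^+ 2 / 2 * (sigma ^+ 2 / n%:R) =
    L * eta ^+ 2 * sigma ^+ 2 / (2 * n%:R).
  by field; rewrite pnatr_eq0 -lt0n n_gt0.
rewrite E in hB'; apply: le_trans h _; rewrite -/m -/H; lra.
Qed.

(** The expected squared norm of the gradient at the average. *)
Definition grad2 l := nrm2 P (fun w => grad (favg f) (xbar (s + l)%N w)).

Lemma value_start : value 0 = Ex P (fun w => favg f (xbar (2 * r * tau)%N w)).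
Proof. by congr Ex; apply/funext => w; rewrite addn0 xbar_start. Qed.

Lemma round_progress : delta <= L -> db <= 2 * L -> rho <= L ->
  4 * eta * L <= 1 -> eta * tau%:R * rho <= 1 ->
  eta * tau%:R * Num.sqrt (db * delta) <= 12^-1 ->
  value tau <= value 0 - eta / 2 * (\sum_(0 <= l < tau) grad2 l)
     + 4 * tau%:R * L * eta ^+ 2 * sigma ^+ 2 / n%:R
     + 640 * eta ^+ 3 * db ^+ 2 * tau%:R ^+ 2 * sigma ^+ 2.
Proof.
move=> dL dbL rL etaL etarho etaS.
have eL : eta * (L + rho) <= 2.
  by have := ler_wpM2l (ltW eta_gt0) rL; lra.
apply: (@round_descent _ tau n%:R L eta delta db rho (sigma ^+ 2)
  drift2 consensus (fun l => nrm2 P (mbar l)) grad2 value) => //.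
- by rewrite ltnW.
- by rewrite ltr0n.
- exact: sqr_ge0.
- by rewrite delta_ge0.
- by rewrite db_ge0.
- by move=> l; exact: nrm2_ge0.
- by rewrite drift2_0.
- by rewrite consensus_0.
- by move=> l; exact: nrm2_ge0.
- by move=> l; exact: drift2_step.
- by move=> l; exact: consensus_step.
- by move=> l lt; apply: value_step => //; lra.
Qed.

End Round.

Lemma total_progress : delta <= L -> db <= 2 * L -> rho <= L ->
  4 * eta * L <= 1 -> eta * tau%:R * rho <= 1 ->
  eta * tau%:R * Num.sqrt (db * delta) <= 12^-1 ->
  eta / 2 * (\sum_(0 <= r < N) \sum_(0 <= l < tau) grad2 r l) <=
  favg f x0 - inf (range (favg f))
  + N%:R * (4 * tau%:R * L * eta ^+ 2 * sigma ^+ 2 / n%:R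
            + 640 * eta ^+ 3 * db ^+ 2 * tau%:R ^+ 2 * sigma ^+ 2).
Proof.
move=> dL dbL rL etaL etarho etaS.
set K := _ + 640 * _ * _ * _ * _.
pose phi r := Ex P (fun w => favg f (xbar (2 * r * tau)%N w)).
have round r : (r < N)%N ->
    eta / 2 * (\sum_(0 <= l < tau) grad2 r l) <= phi r - phi r.+1 + K.
  move=> rN; have := round_progress rN dL dbL rL etaL etarho etaS.
  rewrite value_start // -/(phi r) /value round_end -/(phi r.+1) /K; lra.
have : eta / 2 * (\sum_(0 <= r < N) \sum_(0 <= l < tau) grad2 r l) <=
    \sum_(0 <= r < N) (phi r - phi r.+1 + K).
  by rewrite mulr_sumr; apply: ler_sum_nat => r /andP[_ rN]; exact: round.
rewrite big_split /= sumr_const_nat subn0 -[K *+ N]mulr_natl.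
have -> : \sum_(0 <= r < N) (phi r - phi r.+1) = phi 0%N - phi N.
  rewrite -[RHS]opprB -(telescope_sumr phi (leq0n N)) -sumrN.
  by apply: eq_bigr => r _; rewrite opprB.
have -> : phi 0%N = favg f x0.
  rewrite -(Ex_cst P (favg f x0)) /phi muln0 mul0n; congr Ex.
  apply/funext => w; congr favg; rewrite -[RHS](avg_cst n_gt0); congr avg.
  by apply/funext => i; rewrite (scaffold_init (sc w)).
have : inf (range (favg f)) <= phi N.
  rewrite -(Ex_cst P (inf _)); apply: Ex_le; first exact: itg_cst.
    by apply: itg_favg; exact: L2v_xbar.
  by move=> w; apply: ge_inf => //; exists (xbar (2 * N * tau)%N w).
lra.
Qed.

End Expectations.

(** * Choice of the stepsize *)

Section Stepsize.
Context {R : realType} (n tau N : nat) (L Delta sigma delta db rho : R).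
Context (n_gt0 : (0 < n)%N) (tau_gt0 : (0 < tau)%N) (N_gt0 : (0 < N)%N).
Context (L_gt0 : 0 < L) (Delta_gt0 : 0 < Delta) (sigma_ge0 : 0 <= sigma)
  (delta_ge0 : 0 <= delta) (db_ge0 : 0 <= db) (rho_ge0 : 0 <= rho).

Let S := Num.sqrt (db * delta).

(** The inverse stepsizes that balance the optimization error against the two
    noise terms. *)
Let a := Num.sqrt (L * sigma ^+ 2 * N%:R * tau%:R / (n%:R * Delta)).
Let b := (db ^+ 2 * tau%:R ^+ 2 * sigma ^+ 2 * N%:R / Delta) `^ 3^-1.

(** The inverse of the sum of all required inverse stepsizes. It is positive and
    satisfies each constraint, also when some parameters vanish. *)
Definition stepsize : R := (4 * L + 12 * tau%:R * S + tau%:R * rho + a + b)^-1.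

Let nR : 0 < n%:R :> R. Proof. by rewrite ltr0n. Qed.
Let tR : 0 < tau%:R :> R. Proof. by rewrite ltr0n. Qed.
Let NR : 0 < N%:R :> R. Proof. by rewrite ltr0n. Qed.
Let S0 : 0 <= S. Proof. exact: sqrtr_ge0. Qed.
Let a0 : 0 <= a. Proof. exact: sqrtr_ge0. Qed.
Let b0 : 0 <= b. Proof. exact: powR_ge0. Qed.
Let tS0 : 0 <= tau%:R * S. Proof. by rewrite mulr_ge0 // ltW. Qed.
Let tr0 : 0 <= tau%:R * rho. Proof. by rewrite mulr_ge0 // ltW. Qed.
Let q := 4 * L + 12 * tau%:R * S + tau%:R * rho + a + b.
Let q0 : 0 < q. Proof. by rewrite /q; move: L_gt0 tS0 tr0 a0 b0; lra. Qed.

Lemma stepsize_gt0 : 0 < stepsize. Proof. by rewrite invr_gt0. Qed.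

Let stepsize_le c : c <= q -> stepsize * c <= 1.
Proof. by move=> cq; rewrite mulrC ler_pdivrMr // mul1r. Qed.

Lemma stepsize_L : 4 * stepsize * L <= 1.
Proof.
by rewrite mulrAC mulrC; apply: stepsize_le; rewrite /q; move: tS0 tr0 a0 b0; lra.
Qed.

Lemma stepsize_rho : stepsize * tau%:R * rho <= 1.
Proof.
by rewrite -mulrA; apply: stepsize_le; rewrite /q; move: L_gt0 tS0 tr0 a0 b0; lra.
Qed.

Lemma stepsize_S : stepsize * tau%:R * S <= 12^-1.
Proof.
have : stepsize * (12 * tau%:R * S) <= 1.
  by apply: stepsize_le; rewrite /q; move: L_gt0 tS0 tr0 a0 b0; lra.
lra.
Qed.

Let A := Num.sqrt (L * Delta * sigma ^+ 2 / (n%:R * tau%:R * N%:R)).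
Let B := ((db * Delta * sigma) `^ (2 / 3)) / (tau%:R `^ (1 / 3) * N%:R `^ (2 / 3)).

Let cube (u v : R) : 0 <= u -> (u `^ (v / 3)) ^+ 3 = u `^ v.
Proof.
by move=> u0; rewrite -powR_mulrn ?powR_ge0 // -powRrM divfK.
Qed.

Let aE : a * (Delta / (N%:R * tau%:R)) = A.
Proof.
apply: (@pexpIrn _ 2) => //; rewrite ?nnegrE ?sqrtr_ge0 //.
  by rewrite mulr_ge0 // divr_ge0 ?mulr_ge0 // ltW.
have h1 : 0 <= L * sigma ^+ 2 * N%:R * tau%:R / (n%:R * Delta).
  by rewrite divr_ge0 ?mulr_ge0 ?sqr_ge0 // ltW.
have h2 : 0 <= L * Delta * sigma ^+ 2 / (n%:R * tau%:R * N%:R).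
  by rewrite divr_ge0 ?mulr_ge0 ?sqr_ge0 // ltW.
rewrite exprMn !sqr_sqrtr //; field.
by rewrite !gt_eqF.
Qed.

Let b3 : b ^+ 3 = db ^+ 2 * tau%:R ^+ 2 * sigma ^+ 2 * N%:R / Delta.
Proof.
have h : 0 <= db ^+ 2 * tau%:R ^+ 2 * sigma ^+ 2 * N%:R / Delta.
  by rewrite divr_ge0 ?mulr_ge0 ?sqr_ge0 // ltW.
by rewrite /b -[3^-1]mul1r cube // powRr1.
Qed.

Let bE : b * (Delta / (N%:R * tau%:R)) = B.
Proof.
apply: (@pexpIrn _ 3) => //; rewrite ?nnegrE.
- by rewrite mulr_ge0 // divr_ge0 ?mulr_ge0 // ltW.
- by rewrite divr_ge0 ?mulr_ge0 ?powR_ge0.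
have X0 : 0 <= db * Delta * sigma by rewrite !mulr_ge0 // ltW.
have -> : B ^+ 3 = (db * Delta * sigma) ^+ 2 / (tau%:R * N%:R ^+ 2).
  rewrite /B expr_div_n exprMn !cube ?ler0n // powRr1 ?ler0n //.
  by rewrite !powR_mulrn ?ler0n.
rewrite exprMn b3; field.
by rewrite !gt_eqF.
Qed.

Lemma stepsize_rate (Sum : R) :
  stepsize / 2 * Sum <= Delta + N%:R *
    (4 * tau%:R * L * stepsize ^+ 2 * sigma ^+ 2 / n%:R
     + 640 * stepsize ^+ 3 * db ^+ 2 * tau%:R ^+ 2 * sigma ^+ 2) ->
  2 / (2 * N * tau)%:R * Sum <=
  2000 * ((L / tau%:R + S + rho) * (Delta / N%:R) + A + B).
Proof.
have e0 := stepsize_gt0; set eta := stepsize in e0 *.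
have eq : eta * q = 1 by rewrite mulVf ?gt_eqF.
pose w := Delta / (N%:R * tau%:R).
have w0 : 0 < w by rewrite divr_gt0 ?mulr_gt0.
move=> h.
have h1 : 2 / (2 * N * tau)%:R * Sum <= 2 * q * w
    + 8 * (L * eta * sigma ^+ 2 / n%:R) + 1280 * (eta ^+ 2 * db ^+ 2 * tau%:R * sigma ^+ 2).
  rewrite !natrM.
  have k0 : 0 < 2 * q / (N%:R * tau%:R) by rewrite divr_gt0 ?mulr_gt0.
  have := ler_wpM2l (ltW k0) h.
  have -> : 2 * q / (N%:R * tau%:R) * (eta / 2 * Sum) =
      (eta * q) * (2 / (2 * N%:R * tau%:R) * Sum).
    by field; rewrite !gt_eqF.
  rewrite eq mul1r => h'; apply: le_trans h' _.
  rewrite le_eqVlt; apply/orP; left; apply/eqP.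
  have -> : 2 * q / (N%:R * tau%:R) * (Delta + N%:R *
    (4 * tau%:R * L * eta ^+ 2 * sigma ^+ 2 / n%:R
     + 640 * eta ^+ 3 * db ^+ 2 * tau%:R ^+ 2 * sigma ^+ 2)) =
     2 * q * (Delta / (N%:R * tau%:R)) + 8 * (L * ((eta * q) * eta) * sigma ^+ 2 / n%:R)
     + 1280 * ((eta * q) * eta ^+ 2 * db ^+ 2 * tau%:R * sigma ^+ 2).
    by field; rewrite !gt_eqF.
  by rewrite eq !mul1r.
have hA : L * eta * sigma ^+ 2 / n%:R <= A.
  have -> : L * eta * sigma ^+ 2 / n%:R = (eta * a) * (a * w).
    have -> : (eta * a) * (a * w) = eta * a ^+ 2 * w by ring.
    rewrite sqr_sqrtr /w; first by field; rewrite !gt_eqF.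
    by rewrite divr_ge0 ?mulr_ge0 ?sqr_ge0 // ltW.
  rewrite aE ler_piMl ?sqrtr_ge0 //; apply: stepsize_le.
  by rewrite /q; move: L_gt0 tS0 tr0 a0 b0; lra.
have hB : eta ^+ 2 * db ^+ 2 * tau%:R * sigma ^+ 2 <= B.
  have -> : eta ^+ 2 * db ^+ 2 * tau%:R * sigma ^+ 2 = (eta * b) ^+ 2 * (b * w).
    have -> : (eta * b) ^+ 2 * (b * w) = eta ^+ 2 * b ^+ 3 * w by ring.
    by rewrite b3 /w; field; rewrite !gt_eqF.
  rewrite bE ler_piMl ?divr_ge0 ?mulr_ge0 ?powR_ge0 // expr_le1 // ?mulr_ge0 ?(ltW e0) //.
  by apply: stepsize_le; rewrite /q; move: L_gt0 tS0 tr0 a0 b0; lra.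
apply: le_trans h1 _.
have -> : 2 * q * w = 2 * ((4 * (L / tau%:R) + 12 * S + rho) * (Delta / N%:R)
   + a * w + b * w).
  by rewrite /q /w; field; rewrite !gt_eqF.
rewrite aE bE.
have W0 : 0 < Delta / N%:R by rewrite divr_gt0.
have Lt : 0 <= L / tau%:R * (Delta / N%:R) by rewrite mulr_ge0 ?divr_ge0 // ltW.
have SW : 0 <= S * (Delta / N%:R) by rewrite mulr_ge0 // ltW.
have rW : 0 <= rho * (Delta / N%:R) by rewrite mulr_ge0 // ltW.
have A0 : 0 <= A by exact: sqrtr_ge0.
have B0 : 0 <= B by rewrite divr_ge0 ?mulr_ge0 ?powR_ge0.
lra.
Qed.

End Stepsize.

(** * The convergence rate *)

Theorem theorem5 (R : realType) :
  exists C : R, 0 < C /\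
  forall (n tau N : nat) (L Delta sigma delta deltabar rho : R),
    (1 <= n)%N -> (2 <= tau)%N -> (1 <= N)%N ->
    0 < L -> 0 < Delta -> 0 <= sigma ->
    0 <= delta <= L -> 0 <= deltabar <= 2 * L -> 0 <= rho <= L ->
  exists eta : R, 0 < eta /\
  forall (d : nat) (f : 'I_n -> 'rV[R]_d -> R) (x0 : 'rV[R]_d)
    (dO dX : measure_display) (Omega : measurableType dO)
    (Xi : measurableType dX) (P : probability Omega R)
    (xi : nat -> 'I_n -> {RV P >-> Xi}) (G : 'I_n -> 'rV[R]_d -> Xi -> 'rV[R]_d)
    (x : nat -> 'I_n -> Omega -> 'rV[R]_d),
    (forall i y, differentiable (f i) y) ->
    (forall i y z, l2norm (grad (f i) y - grad (f i) z) <= L * l2norm (y - z)) ->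
    has_lbound (range (favg f)) ->
    Delta = favg f x0 - inf (range (favg f)) ->
    (forall i, measurable_fun [set: borel_rV R d * Xi]
       (fun p : borel_rV R d * Xi => G i p.1 p.2 : borel_rV R d)) ->
    iid_samples (2 * N * tau) xi ->
    (forall t i, (t < 2 * N * tau)%N ->
       stochastic_oracle P (f i) sigma (G i) (xi t i)) ->
    (forall y z,
       n%:R^-1 * (\sum_(i < n) l2norm (grad (f i) y - grad (favg f) y
                                 - grad (f i) z + grad (favg f) z) ^+ 2)
         <= delta ^+ 2 * l2norm (y - z) ^+ 2) ->
    (forall i y z,
       l2norm (grad (f i) y - grad (favg f) y
               - grad (f i) z + grad (favg f) z)
         <= deltabar * l2norm (y - z)) ->
    (forall i, convex_function [set: 'rV[R]_d]
       (fun y => f i y + rho / 2 * (y *m y^T) 0 0)) ->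
    (exists a : 'I_n -> R,
       [/\ forall i, 0 <= a i, \sum_(i < n) a i = 1 &
           constant_hessian (convex_comb a f)]) ->
    (forall w : Omega,
       scaffold tau N eta x0 (fun t i => x t i w)
         (fun t i => G i (x t i w) (xi t i w))) ->
    ((2 / (2 * N * tau)%:R)%R%:E *
       \sum_(0 <= r < N) \sum_(0 <= k < tau)
         'E_P[fun w => (l2norm (grad (favg f)
                (avg (fun i => x (2 * r * tau + tau + k)%N i w))) ^+ 2)%R]
     <= (C * ((L / tau%:R + Num.sqrt (deltabar * delta) + rho) * (Delta / N%:R)
              + Num.sqrt (L * Delta * sigma ^+ 2 / (n%:R * tau%:R * N%:R))
              + ((deltabar * Delta * sigma) `^ (2 / 3))
                / (tau%:R `^ (1 / 3) * N%:R `^ (2 / 3))))%R%:E)%E.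
Proof.
exists 2000; split; [by rewrite ltr0n|move=> n tau N L Delta sigma delta deltabar rho].
move=> n1 tau2 N1 L0 Delta0 sigma0 /andP[delta0 deltaL] /andP[db0 dbL] /andP[rho0 rhoL].
have tau1 : (0 < tau)%N by exact: ltnW.
exists (stepsize n tau N L Delta sigma delta deltabar rho).
split; first exact: stepsize_gt0.
move=> d f x0 dO dX Omega Xi P xi G x df lip flb DeltaE mG [indep _] oracle stdsim
  unif wcvx [a [a0 a1 hess]] sc.
set eta := stepsize _ _ _ _ _ _ _ _ _ in sc.
have eta0 : 0 < eta by exact: stepsize_gt0.
have progress := total_progress n1 tau2 df lip mG indep oracle sc L0 delta0 db0 rho0
  eta0 flb stdsim unif wcvx a0 a1 hess deltaL dbL rhoL.
have {}progress := progress (stepsize_L _ _ _ _ _ _ _ L0 rho0)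
  (stepsize_rho _ _ _ _ _ _ _ L0 rho0) (stepsize_S _ _ _ _ _ _ _ L0 rho0).
rewrite -DeltaE in progress.
have {}progress := stepsize_rate n1 tau1 N1 L0 Delta0 sigma0 db0 rho0 progress.
have lF r k : (r < N)%N -> (k < tau)%N ->
    ('E_P[fun w => (l2norm (grad (favg f)
      (avg (fun i => x (2 * r * tau + tau + k)%N i w))) ^+ 2)%R]
    = (grad2 (tau := tau) f P x r k)%:E)%E.
  move=> rN kt; rewrite unlock; under eq_integral do rewrite l2norm_sqr.
  rewrite EFin_Ex //; apply: itg_sqn.
  apply: (L2v_lip (favg_lip n1 L0 df lip)).
    exact: lipschitz_measurable (favg_lip n1 L0 df lip).
  apply: (L2v_xbar tau2 lip mG indep oracle sc).
  apply: (@leq_trans (local_start tau r + tau)%N).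
    by rewrite leq_add2l ltnW.
  by rewrite round_end leq_mul2r leq_mul2l rN !orbT.
rewrite -lee_fin in progress; apply: le_trans progress.
rewrite [leRHS]EFinM; apply: lee_wpmul2l; first by rewrite lee_fin divr_ge0.
rewrite -sumEFin big_nat [leRHS]big_nat; apply: lee_sum => r /andP[_ rN].
rewrite -sumEFin big_nat [leRHS]big_nat; apply: lee_sum => k /andP[_ kt].
by rewrite lF.
Qed.
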